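(* Let $G$ be a chordal graph. The following are equivalent: (1) $R_G$ is F-pure in all characteristics $p>0$; (2) $R_G$ is F-pure in some characteristic $p>0$; (3) $G$ is AT-free; (4) $G$ is weakly closed.
   Context: Graphs are finite and simple. For a graph $G$ on vertex set $[n]=\{1,\dots,n\}$ and a field $\Bbbk$, let $R=\Bbbk[x_1,\dots,x_n,y_1,\dots,y_n]$ and $f_{i,j}=x_iy_j-x_jy_i$. The binomial edge ideal of $G$ is $J_G=(f_{i,j}\mid \{i,j\}\in E(G))\subseteq R$, and $R_G=R/J_G$. ''In characteristic $p$'' means that the base field is $\Bbbk=\mathbb{Z}/p\mathbb{Z}$, $p$ prime. A graph is chordal if it has no induced cycle of length at least $4$. Three (distinct) vertices of a graph form an asteroidal triple if any two of them are connected by a path avoiding the neighborhood of the third, where the neighborhood of $v$ is $N_G(v)=\{u\in V(G)\mid \{u,v\}\in E(G)\}$. A graph is AT-free if it contains no asteroidal triple. A graph $G$ on $n$ vertices is weakly closed if there is a labeling of its vertices by $1,\dots,n$ such that for every edge $\{i,j\}$ with $i<j$ and every integer $k$ with $i<k<j$, either $\{i,k\}\in E(G)$ or $\{k,j\}\in E(G)$. A ring $A$ of prime characteristic $p>0$ is F-pure if the Frobenius map $F:A\to F_*A$, $r\mapsto F_*r^p$, is a pure map of $A$-modules, i.e. $M\to M\otimes_A F_*A$ is injective for every $A$-module $M$. Here $F_*A$ is $A$ regarded as an $A$-module via $r\cdot F_*s=F_*(r^ps)$. *)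

(* Defs.v *)
(* MathComp, with boolp for classical membership in generated submodules. *)
From HB Require Import structures.
From mathcomp Require Import all_boot all_algebra perm.
From mathcomp Require Import generic_quotient ring_quotient boolp freeg mpoly.

Set Implicit Arguments.
Unset Strict Implicit.
Unset Printing Implicit Defensive.

Import GRing.Theory.
Local Open Scope ring_scope.
Local Open Scope quotient_scope.

(** ** Generated submodules and ideals *)

Definition submod_gen (A : nzRingType) (V : lmodType A) (S : V -> Prop) :
    {pred V} :=
  fun v => `[< exists s : seq (A * V),
    (forall c, c \in s -> S c.2) /\ v = \sum_(c <- s) c.1 *: c.2 >].

Definition ideal_gen (A : nzRingType) (S : A -> Prop) : {pred A} :=
  @submod_gen A A^o S.

Section SubmodGen.
Variables (A : nzRingType) (V : lmodType A) (S : V -> Prop).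

Lemma submod_gen_incl v : S v -> v \in submod_gen S.
Proof.
move=> Sv; apply/asboolP; exists [:: (1, v)]; split=> [c|].
  by rewrite inE => /eqP->.
by rewrite big_seq1 scale1r.
Qed.

Lemma submod_gen_scale a v : v \in submod_gen S -> a *: v \in submod_gen S.
Proof.
move=> /asboolP[s [sS ->]]; apply/asboolP.
exists [seq (a * c.1, c.2) | c <- s]; split=> [c /mapP[d ds ->]|]; first exact: (sS d).
by rewrite big_map scaler_sumr; apply: eq_bigr => c _; rewrite scalerA.
Qed.

Lemma submod_gen_zmod_closed : zmod_closed (submod_gen S).
Proof.
split; first by apply/asboolP; exists [::]; rewrite big_nil.
move=> u v Su; rewrite -scaleN1r => /(submod_gen_scale (-1)).
case/asboolP: Su => s [sS ->] /asboolP[t [tS ->]]; apply/asboolP.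
exists (s ++ t); split; last by rewrite big_cat.
by move=> c; rewrite mem_cat => /orP[/sS|/tS].
Qed.

HB.instance Definition _ :=
  GRing.isZmodClosed.Build V (submod_gen S) submod_gen_zmod_closed.
End SubmodGen.

(** ** Tensor products of modules over a commutative ring *)

Section Tensor.
Variables (A : comNzRingType) (M N : lmodType A).

Local Notation free := {freeg (M * N)%type / A}.
Local Notation bas m n := (<< (m, n) >> : free).

Inductive tensor_rel : free -> Prop :=
| TensorDl m m' n : tensor_rel (bas (m + m') n - bas m n - bas m' n)
| TensorDr m n n' : tensor_rel (bas m (n + n') - bas m n - bas m n')
| TensorZl a m n : tensor_rel (bas (a *: m) n - a *: bas m n)
| TensorZr a m n : tensor_rel (bas m (a *: n) - a *: bas m n).

Definition tensor : Type := {ideal_quot (submod_gen tensor_rel)}.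
HB.instance Definition _ := GRing.Zmodule.on tensor.

Definition tens_proj (x : free) : tensor := \pi_({ideal_quot (submod_gen tensor_rel)}) x.

Definition tens (m : M) (n : N) : tensor := tens_proj (bas m n).

Lemma tens_projP x y :
  (tens_proj x = tens_proj y) <-> (x - y \in submod_gen tensor_rel).
Proof.
rewrite /tens_proj Quotient.idealrBE.
by split=> [->|/eqP]; first exact: eqxx.
Qed.

Lemma tens_projB : {morph tens_proj : x y / x - y}.
Proof. by move=> x y; apply: (raddfB \pi_({ideal_quot (submod_gen tensor_rel)})). Qed.

Lemma tens_projD : {morph tens_proj : x y / x + y}.
Proof. by move=> x y; apply: (raddfD \pi_({ideal_quot (submod_gen tensor_rel)})). Qed.

Definition tens_scale (a : A) (x : tensor) : tensor :=
  tens_proj (a *: repr (x : {ideal_quot (submod_gen tensor_rel)})).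

Lemma tens_projK x : tens_proj (repr (x : {ideal_quot (submod_gen tensor_rel)})) = x.
Proof. exact: reprK. Qed.

Lemma tens_scale_proj a x : tens_scale a (tens_proj x) = tens_proj (a *: x).
Proof.
apply/tens_projP; rewrite -scalerBr; apply: submod_gen_scale.
by apply/tens_projP; rewrite tens_projK.
Qed.

Lemma tens_scaleA a b x : tens_scale a (tens_scale b x) = tens_scale (a * b) x.
Proof. by rewrite -[x]tens_projK !tens_scale_proj scalerA. Qed.
Lemma tens_scale1 : left_id 1 tens_scale.
Proof. by move=> x; rewrite -[x]tens_projK tens_scale_proj scale1r. Qed.
Lemma tens_scaleDr : right_distributive tens_scale +%R.
Proof.
move=> a x y; rewrite -[x]tens_projK -[y]tens_projK.
by rewrite -tens_projD !tens_scale_proj -tens_projD scalerDr.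
Qed.
Lemma tens_scaleDl x : {morph tens_scale^~ x : a b / a + b}.
Proof.
by move=> a b; rewrite -[x]tens_projK !tens_scale_proj -tens_projD scalerDl.
Qed.

HB.instance Definition _ := GRing.Zmodule_isLmodule.Build A tensor
  tens_scaleA tens_scale1 tens_scaleDr tens_scaleDl.
End Tensor.

Notation "M ⊗ N" := (tensor M N) (at level 40, left associativity) : type_scope.
Notation "m ⊗ n" := (tens m n) (at level 40, left associativity) : ring_scope.

(** ** F-purity *)

Section FPure.
Variables (A : comNzRingType) (p : nat) (pcharAp : p \in [pchar A]).

(* F_*A: the group A with scalar multiplication r . s = r ^+ p * s. *)
Definition Fpush of p \in [pchar A] : Type := A.
Local Notation FA := (Fpush pcharAp).

HB.instance Definition _ := GRing.Zmodule.on FA.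

Definition Fpush_scale (r : A) (s : FA) : FA := r ^+ p * (s : A).

Lemma Fpush_scaleA a b x : Fpush_scale a (Fpush_scale b x) = Fpush_scale (a * b) x.
Proof. by rewrite /Fpush_scale exprMn mulrA. Qed.
Lemma Fpush_scale1 : left_id 1 Fpush_scale.
Proof. by move=> x; rewrite /Fpush_scale expr1n mul1r. Qed.
Lemma Fpush_scaleDr : right_distributive Fpush_scale +%R.
Proof. by move=> a x y; rewrite /Fpush_scale mulrDr. Qed.
Lemma Fpush_scaleDl x : {morph Fpush_scale^~ x : a b / a + b}.
Proof.
move=> a b; rewrite /Fpush_scale -mulrDl; congr (_ * _).
exact: (pFrobenius_autD_comm pcharAp (mulrC a b)).
Qed.

HB.instance Definition _ := GRing.Zmodule_isLmodule.Build A FA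
  Fpush_scaleA Fpush_scale1 Fpush_scaleDr Fpush_scaleDl.

Definition Frob (r : A) : FA := pFrobenius_aut pcharAp r.

(* The map M -> M ⊗ F_*A below is M = M ⊗ A -> M ⊗ F_*A induced by Frob. *)
Definition F_pure : Prop :=
  forall M : lmodType A, injective (fun m : M => (m ⊗ Frob 1 : M ⊗ FA)).
End FPure.

(** ** Graphs *)

Record sgraph (T : finType) := SGraph {
  adj :> rel T;
  adj_sym : ssrbool.symmetric adj;
  adj_irrefl : irreflexive adj
}.

Section Graphs.
Variables (T : finType) (G : sgraph T).

Definition neighborhood (v : T) : {set T} := [set u | G u v].

Definition induced_cycle (c : seq T) : Prop :=
  [/\ (2 < size c)%N, ucycle G c &
      {in c &, forall u v, G u v -> v = next c u \/ u = next c v}].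

Definition chordal : Prop := forall c, (3 < size c)%N -> ~ induced_cycle c.

Definition connected_avoiding (S : {set T}) (u v : T) : Prop :=
  exists q, [/\ path G u q, uniq (u :: q), last u q = v &
                all [predC S] (u :: q)].

Definition asteroidal_triple (a b c : T) : Prop :=
  uniq [:: a; b; c] /\
  [/\ connected_avoiding (neighborhood c) a b,
      connected_avoiding (neighborhood a) b c &
      connected_avoiding (neighborhood b) c a].

Definition AT_free : Prop := forall a b c, ~ asteroidal_triple a b c.
End Graphs.

(* s v is the label of the vertex v. *)
Definition weakly_closed (n : nat) (G : sgraph 'I_n) : Prop :=
  exists s : {perm 'I_n}, forall i j k : 'I_n,
    G i j -> (s i < s k)%N -> (s k < s j)%N -> G i k \/ G k j.

(** ** Binomial edge ideals *)

Section BinomialEdge.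
Variables (k : fieldType) (n : nat).
Local Notation R := {mpoly k[n + n]}.

Definition xvar (i : 'I_n) : R := 'X_(lshift n i).
Definition yvar (i : 'I_n) : R := 'X_(rshift n i).
Definition fbin (i j : 'I_n) : R := xvar i * yvar j - xvar j * yvar i.

Variable G : sgraph 'I_n.

Definition edge_binomial (f : R) : Prop := exists i j, G i j /\ f = fbin i j.
Definition JG : {pred R} := ideal_gen edge_binomial.

Lemma JG_idealr : idealr_closed JG.
Proof.
have [J0 JB] := submod_gen_zmod_closed (edge_binomial : R^o -> Prop).
split=> [//||a u v Ju Jv].
- apply/asboolP => -[s [sS]] /(congr1 (meval (fun=> 0))) /eqP.
  rewrite meval1 (raddf_sum (meval (fun=> 0))) big_seq big1 ?oner_eq0 // => c cs.
  have [i [j [_ ->]]] := sS c cs; rewrite /= mevalM mevalB !mevalM !mevalXU.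
  by rewrite mulr0 subrr mulr0.
- have Jau : a * u \in JG := submod_gen_scale (V := R^o) a Ju.
  have JNv : - v \in JG by rewrite -sub0r; apply: JB.
  by rewrite -[v]opprK; apply: JB.
Qed.
HB.instance Definition _ := isIdealr.Build R JG JG_idealr.

Definition RG : Type := {ideal_quot JG}.
HB.instance Definition _ := GRing.ComNzRing.on RG.

Lemma pchar_RG p : p \in [pchar k] -> p \in [pchar RG].
Proof.
move=> kp; rewrite inE (pcharf_prime kp) /=.
have -> : p%:R = \pi_({ideal_quot JG}) (p%:R : R) :> RG.
  by rewrite (rmorph_nat \pi_({ideal_quot JG})).
rewrite -[p%:R]mpolyC_nat (pcharf0 kp) mpolyC0.
by rewrite (rmorph0 \pi_({ideal_quot JG})).
Qed.
End BinomialEdge.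

(* R_G is F-pure in characteristic p, i.e. over the base field Z/p. *)
Definition RG_F_pure_in_char (n : nat) (G : sgraph 'I_n) (p : nat)
    (p_pr : prime p) : Prop :=
  F_pure (pchar_RG G (pchar_Fp p_pr)).

(* Main.v *)
Require Import Defs.
From HB Require Import structures.
From mathcomp Require Import all_boot all_order all_algebra all_field perm.
From mathcomp Require Import ring zify.
From mathcomp Require Import generic_quotient ring_quotient boolp freeg mpoly.

(** The implications proved are (1) => (2) => (3) => (4) and (4) => (3) => (1).
    Write J for the binomial edge ideal and f_uv for the minor of u and v.

    F-purity excludes asteroidal triples ([F_pure_AT_free]). Let a, b, c be an
    asteroidal triple. The product h_c of the variables x_w along a path from a
    to b that avoids the neighbors of c satisfies h_c f_ab \in J, so that f_ab
    lies in Q_c := J : h_c; likewise f_bc \in Q_a and f_ca \in Q_b. A splitting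
    of Frobenius on R/J carries colon ideals of J into themselves, and so Q_c +
    (Q_a \cap Q_b) would be a radical ideal. It contains the square of u = x_b
    f_ac = x_a f_bc + x_c f_ab, but not u. Indeed, suppose that r \in Q_c and u
    - r \in Q_a \cap Q_b, and set to zero the variables of all vertices other
    than a, b, c. In the part trilinear in the three vertices, a form vanishing
    when b and c are parallel and when a and c are parallel alternates in three
    vectors of a plane, hence is zero: so u - r does not contribute, r vanishes
    when a and b are parallel, and u does not. To use purity itself rather than
    a splitting, the statement that u lies in Q_c + (Q_a \cap Q_b) is read as
    the solvability of a linear system in one unknown r: purity lets such
    systems descend along Frobenius ([F_pure_linear_system]).

    A chordal AT-free graph is an interval graph (Lekkerkerker and Boland); it
    has a labeling in which an edge from i to j > i forces i to be adjacent to
    every label between them ([chordal_interval_labeling]), which is more than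
    being weakly closed. By induction on the vertex set W, any clique K with no
    visible obstruction can be placed at the left end of an interval order on W
    ([interval_order_of_initial_clique]): cut W at the right end of the vertex
    of K that ends first, order the two sides recursively and glue. When K is
    empty, an extremal vertex supplies a first clique ([admissible_vertex]).
    Conversely an edge of a weakly closed graph cannot jump over a vertex that
    it avoids, so a path cannot either, and the middle vertex of a triple
    separates the other two ([weakly_closed_AT_free]).

    For such a labeling v_1, ..., v_n and a prime p, let f be the product of
    y_(v_1), of the minors of consecutive vertices and of x_(v_n). Its leading
    monomial is the product of all the variables, so that s |-> Tr (f^(p-1) s)
    splits Frobenius on R up to a nonzero constant, Tr being the trace of
    Frobenius. Moreover f^(p-1) J lies in the ideal J^[p] generated by the p-th
    powers of the f_ij with ij an edge ([chain_annihilates]), so that the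
    splitting descends to R/J ([F_pure_of_interval_labeling]). *)

Set Implicit Arguments.
Unset Strict Implicit.
Unset Printing Implicit Defensive.

(** * Asteroidal triples and extremal vertices *)

Section LekkerkerkerBoland.
Variables (T : finType) (G : sgraph T).
Implicit Types (A B W K S : {set T}) (x y v w : T).

Definition far x y := (x != y) && ~~ G x y.

Lemma far_sym : ssrbool.symmetric far.
Proof. by move=> x y; rewrite /far eq_sym adj_sym. Qed.

Definition away W v := [set w in W | far w v].

Lemma in_away W v w : (w \in away W v) = (w \in W) && far w v.
Proof. by rewrite inE. Qed.

Definition joined A := connect [rel u w | [&& u \in A, w \in A & G u w]].

Lemma joined_sym A : connect_sym [rel u w | [&& u \in A, w \in A & G u w]].
Proof. by apply: sym_connect_sym => x y /=; rewrite adj_sym andbCA. Qed.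

Lemma joined1 A x y : x \in A -> y \in A -> G x y -> joined A x y.
Proof. by move=> xA yA xy; apply: connect1; rewrite /= xA yA. Qed.

Lemma joined_in A x y : joined A x y -> x \in A -> y \in A.
Proof.
case/connectP => p; elim: p x => [x _ -> //|z p IHp x /= /andP[/and3P[_ zA _] pz]].
by move=> yE _; apply: IHp pz yE zA.
Qed.

Lemma joined_subset A B x y : A \subset B -> joined A x y -> joined B x y.
Proof.
move=> /subsetP sAB; apply: connect_sub => u w /= /and3P[uA wA uw].
by apply: joined1 => //; apply: sAB.
Qed.

Lemma joined_avoiding A S x y : x \in A -> {in A, forall u, u \notin S} ->
  joined A x y -> connected_avoiding G S x y.
Proof.
move=> xA AS /connectP[p px ->].
case/shortenP: px => q qx uq _; exists q; split=> //.
  by apply: sub_path qx => u w /= /and3P[].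
rewrite /= AS //=; elim: q x xA qx {uq} => //= z q IHq x xA /andP[/and3P[_ zA _] qz].
by rewrite AS //=; apply: IHq qz.
Qed.

Lemma AT_free_away W x y v : AT_free G -> x \in W -> y \in W ->
  joined (away W v) x y -> joined (away W x) y v -> joined (away W y) x v ->
  far x v -> far y v -> far x y -> False.
Proof.
move=> ATG xW yW xyv yvx xvy xv yv xy; apply: (ATG x y v); split.
  by case/andP: xv => xv _; case/andP: yv => yv _; case/andP: xy => xy _;
     rewrite /= !inE negb_or xy xv yv.
have avoid u : {in away W u, forall t, t \notin neighborhood G u}.
  by move=> t; rewrite inE in_set => /andP[_ /andP[]].
split.
- by apply: joined_avoiding xyv; rewrite ?in_away ?xW.
- by apply: joined_avoiding yvx; rewrite ?in_away ?yW // far_sym.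
- apply: joined_avoiding (avoid y) _.
    by apply: joined_in xvy _; rewrite in_away xW.
  by rewrite /joined joined_sym.
Qed.

Definition reaches A x K := (x \in A) && [exists k in K, joined A x k].

Lemma reaches_step A x y K : x \in A -> G x y -> reaches A y K -> reaches A x K.
Proof.
move=> xA xy /andP[yA /exists_inP[k kK yk]]; rewrite /reaches xA.
by apply/exists_inP; exists k => //; apply: connect_trans yk; apply: joined1.
Qed.

Lemma reaches0 A x K : x \in A -> x \in K -> reaches A x K.
Proof.
move=> xA xK; rewrite /reaches xA; apply/exists_inP; exists x => //.
exact: connect0.
Qed.

(** In an interval representation of W with K at its left end, a vertex x that
    reaches K while avoiding the neighbors of y lies on the left of y. So no
    two vertices may do this to each other. *)
Definition admissible W K :=
  forall x y, reaches (away W y) x K -> reaches (away W x) y K -> False.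

(** The sum of 2 ^ #|C| over the vertices w away from v, with C the component
    of w there. Any weight of a component C that grows fast enough with #|C|
    would do; summing over vertices rather than over components spares the
    choice of representatives. *)
Definition spread W v := (\sum_(w in away W v) 2 ^ #|joined (away W v) w|)%N.

(** Moving from v to x destroys only the component C of x away from v: every
    other component either survives or is absorbed into the component of v and
    y away from x. The latter strictly contains the component D of y away from
    v, because x and y are in different components away from v by AT-freeness.
    So the spread loses #|C| 2 ^ #|C| and gains at least #|D| 2 ^ #|D|, besides
    the term of v. *)
Lemma spread_lt W v x y : AT_free G -> v \in W ->
    reaches (away W y) x [set v] -> reaches (away W x) y [set v] ->
    (#|joined (away W v) x| <= #|joined (away W v) y|)%N ->
  (spread W v < spread W x)%N.
Proof.
move=> ATG vW /andP[xy /exists_inP[_ /set1P-> xvy]].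
move=> /andP[yx /exists_inP[_ /set1P-> yvx]].
set A := away W v; set B := away W x => le_xy.
have [xW far_xy] : x \in W /\ far x y by apply/andP; rewrite -in_away.
have yW : y \in W by move: yx; rewrite in_away => /andP[].
have vB : v \in B by apply: joined_in yvx _.
have := joined_in xvy xy; rewrite in_away vW far_sym /= => far_yv.
have far_xv : far x v by move: vB; rewrite in_away vW far_sym.
have xA : x \in A by rewrite in_away xW.
have yA : y \in A by rewrite in_away yW.
have Nxy : ~~ joined A x y by apply/negP => xyv; apply: AT_free_away xyv yvx xvy _ _ _.
have AB w : w \in A -> ~~ joined A x w -> w \in B.
  move=> wA xw; move: (wA); rewrite !in_away => /andP[-> _] /=.
  apply: contraR xw; rewrite negb_and !negbK => /orP[/eqP->|wx].
    exact: connect0.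
  by apply: joined1 => //; rewrite adj_sym.
have JB w u : w \in A -> ~~ joined A x w -> joined A w u -> joined B w u.
  move=> wA xw /connectP[p]; elim: p w wA xw => [w _ _ _ ->|z p IHp w wA xw].
    exact: connect0.
  move=> /= /andP[/and3P[_ zA wz] pz] uE.
  have xz : ~~ joined A x z.
    by apply: contra xw => xz; apply: connect_trans xz (joined1 _ _ _);
       rewrite // adj_sym.
  apply: connect_trans (joined1 _ _ wz) (IHp _ zA xz pz uE); exact: AB.
have cB w : w \in A -> ~~ joined A x w -> (#|joined A w| <= #|joined B w|)%N.
  by move=> wA xw; apply: subset_leq_card; apply/subsetP => u; apply: JB.
have cBy w : joined A y w -> (#|joined A y| < #|joined B w|)%N.
  move=> yw; have JByw : joined B w y by rewrite /joined joined_sym; apply: JB.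
  apply: proper_card; apply/properP; split.
    by apply/subsetP => u yu; apply: connect_trans JByw _; apply: JB.
  exists v; first exact: connect_trans JByw yvx.
  apply/negP => yv; have := joined_in yv yA.
  by rewrite in_away /far eqxx andbF.
have cA u w : joined A u w -> #|joined A w| = #|joined A u|.
  move=> uw; apply: eq_card => t; rewrite -!topredE /=.
  exact: esym (same_connect (joined_sym A) uw t).
rewrite /spread -/A -/B (bigID (joined A x)) /= addnC.
have -> : (\sum_(w in B) 2 ^ #|joined B w| = 2 ^ #|joined B v| + 
   \sum_(w in B | w != v) 2 ^ #|joined B w|)%N by rewrite (bigD1 v).
have le1 : (\sum_(w in A | ~~ joined A x w) 2 ^ #|joined B w|
            <= \sum_(w in B | w != v) 2 ^ #|joined B w|)%N.
  rewrite [leqRHS](bigID (fun w => (w \in A) && ~~ joined A x w)) /=.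
  apply: leq_trans (leq_addr _ _); apply: eq_leq; apply: eq_bigl => w.
  case wA: (w \in A); last by rewrite !andbF.
  case xw: (joined A x w); first by rewrite !andbF.
  rewrite AB ?xw //=; move: wA; rewrite andbT in_away => /andP[_ /andP[-> _]].
  by [].
have le2 : (\sum_(w in A | joined A x w) 2 ^ #|joined A w|
   + \sum_(w in A | ~~ joined A x w) 2 ^ #|joined A w|
   <= \sum_(w in A | ~~ joined A x w) 2 ^ #|joined B w|)%N.
  rewrite [X in (_ + X)%N](bigID (joined A y)) [leqRHS](bigID (joined A y)) /= addnA.
  apply: leq_add; last first.
    by apply: leq_sum => w /andP[/andP[wA xw] _]; rewrite leq_exp2l // cB.
  have -> : (\sum_(w in A | joined A x w) 2 ^ #|joined A w|
     = #|joined A x| * 2 ^ #|joined A x|)%N.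
    rewrite -sum_nat_const; apply: eq_big => [w|w /andP[_ /cA-> //]].
    by rewrite andb_idl // => xw; apply: joined_in xw xA.
  have yE w : (w \in A) && ~~ joined A x w && joined A y w = (w \in joined A y).
    rewrite -[RHS]topredE /=; apply/andb_idl => yw; rewrite (joined_in yw) //.
    apply: contra Nxy => xw; apply: connect_trans xw _.
    by rewrite -/(joined A w y) /joined joined_sym.
  have -> : (\sum_(w | (w \in A) && ~~ joined A x w && joined A y w) 2 ^ #|joined A w|
     = #|joined A y| * 2 ^ #|joined A y|)%N.
    rewrite -sum_nat_const; apply: eq_big => [w|w]; first exact: yE.
    by case/andP => _ /cA->.
  apply: (@leq_trans (#|joined A y| * 2 ^ (#|joined A y|).+1)).
    rewrite expnS mulnA muln2 -addnn mulnDl leq_add2r.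
    by apply: leq_mul => //; rewrite leq_exp2l.
  rewrite -sum_nat_const; rewrite (eq_bigl _ _ yE).
  by apply: leq_sum => w yw; rewrite leq_exp2l // cBy.
rewrite addnC; apply: leq_ltn_trans le2 _; apply: leq_ltn_trans le1 _.
by rewrite -[ltnLHS]add0n ltn_add2r expn_gt0.
Qed.

(** A vertex of maximal spread is extremal: if x and y both reached v while
    avoiding each other, moving from v to the one with the smaller component
    would increase the spread. *)
Lemma admissible_vertex W : AT_free G -> W != set0 ->
  exists2 v, v \in W & admissible W [set v].
Proof.
move=> ATG /set0Pn[v0 v0W]; pose v := [arg max_(v > v0 in W) spread W v].
have [vW vmax] : v \in W /\ forall u, u \in W -> (spread W u <= spread W v)%N.
  by rewrite /v; case: arg_maxnP => // u uW umax; split.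
exists v => // x y xy yx.
wlog le_xy : x y xy yx / (#|joined (away W v) x| <= #|joined (away W v) y|)%N.
  by move=> th; case: (leqP #|joined (away W v) x| #|joined (away W v) y|) => [|/ltnW];
     apply: th.
have := spread_lt ATG vW xy yx le_xy; rewrite ltnNge vmax //.
by case/andP: xy; rewrite in_away => /andP[].
Qed.

(** * Interval orders from an initial clique *)

Definition C4_free := forall a b c d,
  G a b -> G b c -> G c d -> G d a -> far a c -> far b d -> False.

Definition C5_free := forall a b c d e,
  G a b -> G b c -> G c d -> G d e -> G e a ->
  far a c -> far a d -> far b d -> far b e -> far c e -> False.

Lemma far_irrefl x : far x x = false.
Proof. by rewrite /far eqxx. Qed.

Lemma adj_notfar x y : G x y -> ~~ far x y.
Proof. by move=> xy; rewrite /far xy andbF. Qed.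

Lemma notfarP x y : reflect (x = y \/ G x y) (~~ far x y).
Proof.
rewrite negb_and !negbK.
by apply: (iffP orP) => [[/eqP xy|xy]|[->|xy]]; [left|right|left|right].
Qed.

(** A strict order whose comparable pairs are the pairs of distinct nonadjacent
    vertices: the relation of lying entirely on the left, for an interval
    representation of the subgraph induced on W. *)
Definition orders W (lt : rel T) :=
  {in W &, forall x y, lt x y || lt y x = far x y} /\
  {in W & &, forall x y z, lt x y -> lt y z -> lt x z}.

Definition initial W (lt : rel T) K := {in K & W, forall k w, ~~ lt w k}.

Definition clique K := {in K &, forall k l, ~~ far k l}.

Section Step.
Hypotheses (ATG : AT_free G) (C4G : C4_free) (C5G : C5_free).
Variables (W K : {set T}).
Hypotheses (KW : K \subset W) (cK : clique K) (aK : admissible W K).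
Hypothesis IH : forall W' K', #|W'| < #|W| -> K' \subset W' -> clique K' ->
  admissible W' K' -> exists lt, orders W' lt /\ initial W' lt K'.

Variable k0 : T.
Hypothesis k0K : k0 \in K.
Hypothesis k0min : forall k, k \in K ->
  #|[set w in W | ~~ far w k0]| <= #|[set w in W | ~~ far w k]|.

(* In an interval representation with K at the left end, k0 is the vertex of
   K that ends first. Then M is its closed neighborhood, H consists of what
   starts after k0 has ended, and S of the vertices of M that extend into H. *)
Let M := [set w in W | ~~ far w k0].
Let H := away W k0.
Let S := [set s in M | [exists h in H, G s h]].
Let X := M :\: K.

Let k0W : k0 \in W. Proof. exact: (subsetP KW). Qed.

(** The closed neighborhoods of the members of K form a chain, since private
    neighbors of two members would close a 4-cycle if adjacent, and reach K
    avoiding each other if not; k0 has the smallest one. *)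
Lemma clique_universal k m : k \in K -> m \in M -> ~~ far k m.
Proof.
move=> kK; rewrite inE => /andP[mW mk0]; apply/negP => km.
have kW := subsetP KW _ kK.
have [m' /andP[m'W m'k] m'k0] :
    exists2 m', (m' \in W) && ~~ far m' k & far m' k0.
  apply/exists_inP; apply: contraT; rewrite negb_exists_in => /forall_inP all_near.
  suff: #|[set w in W | ~~ far w k]| < #|M| by rewrite ltnNge k0min.
  apply: proper_card; apply/properP; split.
    by apply/subsetP => w; rewrite !inE => wWk; rewrite all_near //; case/andP: wWk => ->.
  by exists m; rewrite !inE mW // far_sym km.
have kk0 : G k k0.
  by case/notfarP: (cK kK k0K) => // kE; rewrite kE far_sym (negPf mk0) in km.
have mk0' : G m k0.
  by case/notfarP: mk0 => // mE; rewrite mE in km; rewrite (negPf (cK kK k0K)) in km.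
have m'k' : G m' k.
  case/notfarP: m'k => // m'E; rewrite m'E in m'k0.
  by rewrite (negPf (cK kK k0K)) in m'k0.
have mm' : far m m'.
  apply/negPn/negP => /notfarP[mE|mm']; first by rewrite -mE (negPf mk0) in m'k0.
  apply: (C4G (a := k0) (b := m) (c := m') (d := k)) => //.
  - by rewrite adj_sym.
  - by rewrite far_sym.
  - by rewrite far_sym.
apply: (aK (x := m) (y := m')).
  apply: reaches_step mk0' _; first by rewrite in_away mW.
  by apply: reaches0; rewrite ?in_away ?k0W // far_sym.
apply: reaches_step m'k' _; first by rewrite in_away m'W far_sym.
by apply: reaches0; rewrite ?in_away ?kW.
Qed.

Let inS s : s \in S -> [/\ s \in W, G s k0 & exists2 h, h \in H & G s h].
Proof.
rewrite inE in_set => /andP[/andP[sW sk0] /exists_inP[h hH sh]]; split=> //;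
  last by exists h.
case/notfarP: sk0 => // sE; move: hH; rewrite in_away far_sym -sE => /andP[_].
by rewrite (negPf (adj_notfar sh)).
Qed.

Let inH h : h \in H -> h \in W /\ far h k0.
Proof. by rewrite in_away => /andP. Qed.

Let MH s h : s \in M -> h \in H -> ~~ G s h -> far s h.
Proof.
rewrite in_set in_away => /andP[_ sk0] /andP[_ hk0] sh; rewrite /far sh andbT.
by apply: contra sk0 => /eqP->.
Qed.

Let SM s : s \in S -> s \in M.
Proof. by rewrite inE => /andP[]. Qed.

Lemma no_fork s s' h h' : s \in S -> s' \in S -> h \in H -> h' \in H ->
  G s h -> G s' h' -> far s h' -> far s' h -> far h h' -> False.
Proof.
move=> /inS[sW sk0 _] /inS[s'W s'k0 _] /inH[hW hk0] /inH[h'W h'k0] sh s'h' sh' s'h hh'.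
apply: (aK (x := h) (y := h')).
  apply: (reaches_step (y := s)); rewrite ?in_away ?hW // 1?adj_sym //.
  apply: reaches_step sk0 _; rewrite ?in_away ?sW //.
  by apply: reaches0; rewrite ?in_away ?k0W // far_sym.
apply: (reaches_step (y := s')); rewrite ?in_away ?h'W 1?far_sym // 1?adj_sym //.
apply: reaches_step s'k0 _; rewrite ?in_away ?s'W //.
by apply: reaches0; rewrite ?in_away ?k0W // far_sym.
Qed.

(** Two nonadjacent vertices of S have in common the neighbor k0; with their
    neighbors in H they form an induced cycle of length 4 or 5, or a fork which
    contradicts the admissibility of K. *)
Lemma boundary_clique : clique S.
Proof.
move=> s s' sS s'S; apply/negP => ss'.
have [sW sk0 [h hH sh]] := inS sS; have [s'W s'k0 [h' h'H s'h']] := inS s'S.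
have [hW hk0] := inH hH; have [h'W h'k0] := inH h'H.
have sh' : far s h'.
  apply: MH; rewrite ?SM //; apply/negP => sh'.
  by apply: (C4G (a := k0) (b := s) (c := h') (d := s')) => //;
    rewrite 1?adj_sym // far_sym.
have s'h : far s' h.
  apply: MH; rewrite ?SM //; apply/negP => s'h.
  by apply: (C4G (a := k0) (b := s) (c := h) (d := s')) => //;
    rewrite 1?adj_sym // far_sym.
have [hh'|/notfarP[hE|hh']] := boolP (far h h').
- exact: no_fork sS s'S hH h'H sh s'h' sh' s'h hh'.
- by rewrite -hE (negPf (adj_notfar sh)) in sh'.
by apply: (C5G (a := k0) (b := s) (c := h) (d := h') (e := s')) => //;
  rewrite 1?adj_sym // far_sym.
Qed.

(** Two vertices of X that reach S avoiding each other have no neighbor in H,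
    as S is a clique. Their paths to S extend to a common vertex d of H (no
    fork), and k0 joins them away from d: with d they form an asteroidal
    triple. *)
Lemma near_side_admissible : admissible X (S :&: X).
Proof.
move=> x y /andP[]; rewrite in_away => /andP[xX xy] /exists_inP[s]; rewrite inE.
move=> /andP[sS sX] xs /andP[]; rewrite in_away => /andP[yX yx] /exists_inP[s'].
rewrite inE => /andP[s'S s'X] ys'.
have sub z : away X z \subset away W z.
  by apply/subsetP => w; rewrite !inE => /andP[/andP[_ /andP[-> _]]].
have sy : s \in away X y by apply: joined_in xs _; rewrite in_away xX.
have s'x : s' \in away X x by apply: joined_in ys' _; rewrite in_away yX.
have XM z : z \in X -> [/\ z \in M, z \in W & G z k0].
  rewrite inE => /andP[zK zM]; split=> //; move: zM; rewrite inE => /andP[// _ /notfarP[]//].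
  by move=> zE; rewrite zE k0K in zK.
have [xM xW xk0] := XM _ xX; have [yM yW yk0] := XM _ yX.
have xNS : x \notin S.
  by apply/negP => xS; move: s'x; rewrite in_away (negPf (boundary_clique s'S xS)) andbF.
have yNS : y \notin S.
  by apply/negP => yS; move: sy; rewrite in_away (negPf (boundary_clique sS yS)) andbF.
(* A common neighbor in H of the ends of the two paths. *)
have [d dH /andP[sd s'd]] : exists2 d, d \in H & G s d && G s' d.
  have [sW sk0 [h hH sh]] := inS sS; have [s'W s'k0 [h' h'H s'h']] := inS s'S.
  case: (boolP (G s' h)) => [s'h|/(MH (SM s'S) hH) s'h]; first by exists h; rewrite ?sh.
  case: (boolP (G s h')) => [sh'|/(MH (SM sS) h'H) sh']; first by exists h'; rewrite ?sh'.
  have [hh'|/notfarP[hE|hh']] := boolP (far h h').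
  - by case: (no_fork sS s'S hH h'H sh s'h' sh' s'h hh').
  - by rewrite -hE (negPf (adj_notfar sh)) in sh'.
  case/notfarP: (boundary_clique sS s'S) => [sE|ss'].
    by rewrite sE (negPf (adj_notfar s'h')) in sh'.
  by case: (C4G (a := s) (b := h) (c := h') (d := s')) => //;
    rewrite 1?adj_sym // far_sym.
have [dW dk0] := inH dH.
have farS z : z \in M -> z \notin S -> far z d.
  move=> zM zS; apply: MH => //; apply: contra zS => zd.
  by rewrite inE zM; apply/exists_inP; exists d.
have xd := farS _ xM xNS; have yd := farS _ yM yNS.
have k0d : k0 \in away W d by rewrite in_away k0W far_sym.
apply: (AT_free_away (x := x) (y := y) (v := d) ATG xW yW) => //.
- apply: (connect_trans (y := k0)); apply: joined1; rewrite // 1?adj_sym // in_away ?xW ?yW //.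
- apply: connect_trans (joined_subset (sub _) ys') (joined1 _ _ s'd).
    exact: subsetP (sub _) _ s'x.
  by rewrite in_away dW far_sym.
- apply: connect_trans (joined_subset (sub _) xs) (joined1 _ _ sd).
    exact: subsetP (sub _) _ sy.
  by rewrite in_away dW far_sym.
Qed.

(** Vertices of H are not adjacent to k0, which is adjacent to all of S: a path
    in S and H from one to S that avoids the other extends to k0 in K. *)
Lemma far_side_admissible : admissible (S :|: H) S.
Proof.
have sub z : away (S :|: H) z \subset away W z.
  apply/subsetP => w; rewrite !in_away in_setU => /andP[/orP[/inS[->]|/inH[->]]] //.
have half x y : reaches (away (S :|: H) x) y S ->
   reaches (away (S :|: H) y) x S -> reaches (away W y) x K.
  move=> /andP[]; rewrite in_away => /andP[ySH yx] _ /andP[xA /exists_inP[s sS xs]].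
  have sA := joined_in xs xA; have [sW sk0 _] := inS sS.
  have /inH[yW yk0] : y \in H.
    case/setUP: ySH => // yS.
    by move: sA; rewrite in_away (negPf (boundary_clique sS yS)) andbF.
  rewrite /reaches (subsetP (sub y)) //; apply/exists_inP; exists k0 => //.
  apply: connect_trans (joined_subset (sub _) xs) (joined1 _ _ sk0).
    exact: subsetP (sub _) _ sA.
  by rewrite in_away k0W far_sym.
by move=> x y xy yx; apply: (aK (x := x) (y := y)); apply: half.
Qed.

(** Both sides are smaller than W. The order of X has S at its left end, so it
    is reversed, which puts S on the right where H follows; vertices of M
    precede those of H not adjacent to them. Transitivity across the cut is
    where it matters that S is initial on both sides. *)
Lemma order_step : exists lt, orders W lt /\ initial W lt K.
Proof.
have MW : M \subset W by apply/subsetP => w; rewrite inE => /andP[].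
have k0M : k0 \in M by rewrite inE k0W far_irrefl.
have [|||lt1 [[cmp1 tr1] ini1]] := IH _ _ _ near_side_admissible.
- apply: proper_card; apply/properP; split; first exact: subset_trans (subsetDl _ _) MW.
  by exists k0; rewrite // inE k0K.
- exact: subsetIr.
- by move=> k l /setIP[kS _] /setIP[lS _]; apply: boundary_clique.
have [|||lt2 [[cmp2 tr2] ini2]] := IH _ _ _ far_side_admissible.
- apply: proper_card; apply/properP; split.
    by apply/subsetP => w /setUP[/inS[]|/inH[]].
  exists k0 => //; rewrite in_setU in_away far_irrefl andbF orbF.
  by apply/negP => /inS[_]; rewrite adj_irrefl.
- exact: subsetUl.
- exact: boundary_clique.
have WMH w : w \in W -> (w \in M) && (w \notin H) || (w \notin M) && (w \in H).
  by rewrite in_set in_away => -> /=; case: (far w k0).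
have inX w : (w \in X) = (w \in M) && (w \notin K) by rewrite inE andbC.
exists (fun a b => [|| [&& a \in X, b \in X & lt1 b a], [&& a \in M, b \in H & far a b]
                    | [&& a \in H, b \in H & lt2 a b]]); split; first split.
- move=> a b aW bW; rewrite !inX.
  have UH w : w \in H -> w \in S :|: H by move=> wH; rewrite inE wH orbT.
  case/orP: (WMH _ aW) => /andP[aM aH]; case/orP: (WMH _ bW) => /andP[bM bH];
    rewrite ?aM ?bM ?aH ?bH ?(negPf aM) ?(negPf bM) ?(negPf aH) ?(negPf bH) /=
            ?orbF ?andbF ?[_ || false]orbF //=.
  + case aK': (a \in K) => /=; first by rewrite andbF /= (negPf (clique_universal aK' bM)).
    case bK': (b \in K) => /=; first by rewrite far_sym (negPf (clique_universal bK' aM)).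
    by rewrite orbC cmp1 // inX ?aM ?bM ?aK' ?bK'.
  + by rewrite far_sym.
  + by rewrite cmp2 // UH.
- have notXH w : w \in X -> w \in H -> False.
    rewrite inX => /andP[wM _] wH; have := WMH w.
    by rewrite wM wH => /(_ (subsetP MW _ wM)).
  have notMH w : w \in M -> w \in H -> False.
    by move=> wM wH; have := WMH w; rewrite wM wH => /(_ (subsetP MW _ wM)).
  have HS w : w \in H -> w \in S :|: H by move=> wH; rewrite inE wH orbT.
  have farS a c : a \in M -> c \in H -> a \notin S -> far a c.
    by move=> aM cH aS; apply: MH => //; apply: contra aS => ac;
       rewrite inE aM; apply/exists_inP; exists c.
  move=> a b c aW bW cW /or3P[] /and3P[aX bX ab] /or3P[] /and3P[bX' cX bc];
    try by [case: (notXH b) | case: (notMH b)].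
  + by rewrite aX cX (tr1 c b a).
  + have aM : a \in M by move: aX; rewrite inX => /andP[].
    rewrite aM cX farS ?orbT //; apply/negP => aS.
    by have := ini1 a b; rewrite inE aS aX ab => /(_ isT bX).
  + rewrite aX cX; suff -> : far a c by rewrite orbT.
    have [aS|/(farS _ _ aX cX)//] := boolP (a \in S).
    have aSH : a \in S :|: H by rewrite inE aS.
    have ltab : lt2 a b.
      have := cmp2 a b aSH (HS _ bX); rewrite ab => /orP[//|].
      by rewrite (negPf (ini2 _ _ aS (HS _ bX))).
    by rewrite -(cmp2 _ _ aSH (HS _ cX)) (tr2 a b c) // HS.
  + by rewrite aX cX (tr2 a b c) // ?HS ?orbT.
- move=> k w kK wW.
  have kM : k \in M by rewrite inE (subsetP KW) // (cK kK k0K).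
  have := WMH _ (subsetP KW _ kK); rewrite kM /= orbF => /negPf ->.
  by rewrite (inX k) kM kK !andbF.
Qed.
End Step.

(** Induction on #|W| by cutting at the member of K with the smallest closed
    neighborhood. If K is empty, it is first replaced by an extremal
    vertex. *)
Lemma interval_order_of_initial_clique W K :
  AT_free G -> C4_free -> C5_free -> K \subset W -> clique K -> admissible W K ->
  exists lt, orders W lt /\ initial W lt K.
Proof.
move=> ATG C4G C5G; have [m] := ubnP #|W|; elim: m W K => // m IHm W K leWm.
have nonempty K' : K' != set0 -> K' \subset W -> clique K' -> admissible W K' ->
    exists lt, orders W lt /\ initial W lt K'.
  case/set0Pn=> k1 k1K KW cK aK.
  pose k0 := [arg min_(k < k1 in K') #|[set w in W | ~~ far w k]|].
  have [k0K k0min] : k0 \in K' /\ forall k, k \in K' ->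
      #|[set w in W | ~~ far w k0]| <= #|[set w in W | ~~ far w k]|.
    by rewrite /k0; case: arg_minnP => // k kK kmin; split.
  apply: (order_step ATG C4G C5G KW cK aK _ k0K k0min) => W' L ltW'.
  by apply: IHm; apply: leq_trans ltW' _.
have [-> _ _ _|K0] := eqVneq K set0; last exact: nonempty.
have ini0 lt : initial W lt set0 by move=> k w; rewrite inE.
have [W0|/(admissible_vertex ATG)[v vW av]] := eqVneq W set0.
  by exists (fun _ _ => false); split=> //; split=> x y; rewrite W0 inE.
have [||k l /set1P-> /set1P->||lt [oW _]] := nonempty [set v]; rewrite ?sub1set ?far_irrefl //.
  by apply/set0Pn; exists v; rewrite inE.
by exists lt.
Qed.

End LekkerkerkerBoland.

(** * Labelings of chordal AT-free graphs *)

Section Chordal.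
Variables (T : finType) (G : sgraph T).

Lemma chordal_C4_free : chordal G -> C4_free G.
Proof.
move=> chG a b c d ab bc cd da /andP[nac /negPf ac] /andP[nbd /negPf bd].
have neq u v : G u v -> u == v = false by apply: contraTF => /eqP->; rewrite adj_irrefl.
have [[[nab nbc] ncd] nda] := (neq _ _ ab, neq _ _ bc, neq _ _ cd, neq _ _ da).
have [nba ncb ndc nad] :
    [/\ b == a = false, c == b = false, d == c = false & a == d = false].
  by split; rewrite eq_sym.
have [nca ndb] : c == a = false /\ d == b = false.
  by split; rewrite eq_sym; apply: negPf.
have [ca db] : G c a = false /\ G d b = false by split; rewrite adj_sym.
move/negPf: nac => nac; move/negPf: nbd => nbd.
apply: (chG [:: a; b; c; d]) => //; split=> //.
  by rewrite /ucycle /= ab bc cd da !inE nab nac nad nbc nbd ncd.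
move=> u v; rewrite !inE => /or4P[] /eqP-> /or4P[] /eqP->;
  rewrite /= ?eqxx ?adj_irrefl ?ac ?bd ?ca ?db
    ?nab ?nac ?nad ?nbc ?nbd ?ncd ?nba ?ncb ?ndc ?nca ?ndb ?nda /= ?eqxx => // _; by [left|right].
Qed.

Lemma chordal_C5_free : chordal G -> C5_free G.
Proof.
move=> chG a b c d e ab bc cd de ea /andP[nac /negPf ac] /andP[nad /negPf ad].
move=> /andP[nbd /negPf bd] /andP[nbe /negPf be] /andP[nce /negPf ce].
have neq u v : G u v -> u == v = false by apply: contraTF => /eqP->; rewrite adj_irrefl.
have [[[nab nbc] ncd] nde] := (neq _ _ ab, neq _ _ bc, neq _ _ cd, neq _ _ de).
have nea := neq _ _ ea.
have [nba ncb ndc ned nae] : [/\ b == a = false, c == b = false, d == c = false,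
   e == d = false & a == e = false].
  by split; rewrite eq_sym.
have [nca nda ndb neb nec] : [/\ c == a = false, d == a = false, d == b = false,
   e == b = false & e == c = false].
  by split; rewrite eq_sym; apply: negPf.
have [ca da db eb ec] : [/\ G c a = false, G d a = false, G d b = false,
   G e b = false & G e c = false] by split; rewrite adj_sym.
move/negPf: nac => nac; move/negPf: nbd => nbd; move/negPf: nad => nad.
move/negPf: nbe => nbe; move/negPf: nce => nce.
apply: (chG [:: a; b; c; d; e]) => //; split=> //.
  by rewrite /ucycle /= ab bc cd de ea !inE nab nac nad nae nbc nbd nbe ncd nce nde.
move=> u v; rewrite !inE => /predU1P[->|/or4P[] /eqP->] /predU1P[->|/or4P[] /eqP->];
  rewrite /= ?eqxx ?adj_irrefl ?ac ?ad ?bd ?be ?ce ?ca ?da ?db ?eb ?ec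
    ?nab ?nac ?nad ?nae ?nbc ?nbd ?nbe ?ncd ?nce ?nde
    ?nba ?ncb ?ndc ?ned ?nca ?nda ?ndb ?nea ?neb ?nec /= ?eqxx => // _; by [left|right].
Qed.

Lemma chordal_interval_order : chordal G -> AT_free G ->
  exists lt, orders G [set: T] lt.
Proof.
move=> chG ATG.
have [|||lt [oT _]] := interval_order_of_initial_clique (W := [set: T]) (K := set0)
  ATG (chordal_C4_free chG) (chordal_C5_free chG).
- exact: sub0set.
- by move=> k l; rewrite inE.
- by move=> x y /andP[_ /exists_inP[k]]; rewrite inE.
by exists lt.
Qed.
End Chordal.

Lemma sorting_perm n (key : 'I_n -> nat) :
  exists s : {perm 'I_n}, forall i j, s i < s j -> key i <= key j.
Proof.
pose leK i j := key i <= key j; pose l := sort leK (enum 'I_n).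
have lP i : i \in l by rewrite mem_sort mem_enum.
have lt_l i : index i l < n.
  by rewrite -[ltnRHS](size_enum_ord n) -(size_sort leK) index_mem.
have inj : injective (fun i => Ordinal (lt_l i)).
  by move=> i j /(congr1 (nth i l \o val)) /=; rewrite !nth_index.
exists (perm inj) => i j; rewrite !permE /=.
have trK : transitive leK by move=> ? ? ?; apply: leq_trans.
have sl : sorted leK l by apply: sort_sorted => ? ?; apply: leq_total.
exact: (sorted_ltn_index trK sl _ _ (lP i) (lP j)).
Qed.

Definition interval_labeling n (G : sgraph 'I_n) (s : {perm 'I_n}) :=
  forall i j k, G i j -> s i < s k -> s k < s j -> G i k.

(** Vertices are listed by the number of their predecessors, that is by left
    endpoints. The sets of predecessors form a chain since G has no induced
    4-cycle. If i precedes k in the list without being adjacent to it, then i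
    is among the predecessors of k, hence of any later j. *)
Lemma chordal_interval_labeling n (G : sgraph 'I_n) :
  chordal G -> AT_free G -> exists s, interval_labeling G s.
Proof.
move=> chG ATG; have [lt [cmp tr]] := chordal_interval_order chG ATG.
have cmpP x y : lt x y || lt y x = far G x y by apply: cmp; rewrite inE.
have tr' x y z : lt x y -> lt y z -> lt x z by apply: tr; rewrite inE.
have irr x : ~~ lt x x by have := cmpP x x; rewrite orbb far_irrefl => ->.
pose pred x := [set z | lt z x].
have pred_sub x y : #|pred x| <= #|pred y| -> pred x \subset pred y.
  move=> le_xy; apply: contraT => /subsetPn[z zx zy].
  suff /proper_card : pred y \proper pred x by rewrite ltnNge le_xy.
  apply/properP; split; last by exists z.
  rewrite !inE in zx zy; apply/subsetP => t; rewrite !inE => ty; apply: contraT => tx.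
  have far_lt u v : lt u v -> far G u v by move=> uv; rewrite -cmpP uv.
  have near u v : ~~ lt u v -> ~~ lt v u -> u = v \/ G u v.
    by move=> uv vu; apply/notfarP; rewrite -cmpP (negPf uv) (negPf vu).
  have zy' : z = y \/ G z y.
    by apply: near => //; apply: contra tx => yz; apply: tr' (tr' _ _ _ ty yz) zx.
  have tx' : t = x \/ G t x.
    by apply: near => //; apply: contra zy => xt; apply: tr' (tr' _ _ _ zx xt) ty.
  have xy : x = y \/ G x y.
    apply: near.
    - by apply: contra zy => xy; apply: tr' zx xy.
    - by apply: contra tx => yx; apply: tr' ty yx.
  have tz : t = z \/ G t z.
    apply: near.
    - by apply: contra tx => tz; apply: tr' tz zx.
    - by apply: contra zy => zt; apply: tr' zt ty.
  have [zx' ty'] := (far_lt _ _ zx, far_lt _ _ ty).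
  have far_adj u v : far G u v -> G u v -> False by move=> /andP[_ /negPf->].
  case: xy => [xE|xy].
    case: zy' => [zE|]; first by rewrite xE zE far_irrefl in zx'.
    by rewrite -xE => zx''; case: (far_adj _ _ zx').
  case: zy' => [zE|zy']; first by rewrite zE far_sym in zx'; case: (far_adj _ _ zx').
  case: tx' => [tE|tx']; first by rewrite tE in ty'; case: (far_adj _ _ ty').
  case: tz => [tE|tz]; first by rewrite tE in tx'; case: (far_adj _ _ zx').
  case: (chordal_C4_free chG (a := z) (b := y) (c := x) (d := t)) => //;
    try by rewrite adj_sym.
  by rewrite far_sym.
have [s sP] := sorting_perm (fun x => #|pred x|).
exists s => i j k ij ik kj; apply: contraT => Nik.
have far_ik : far G i k.
  by rewrite /far Nik andbT; apply: contraTneq ik => ->; rewrite ltnn.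
have : lt i k.
  move: far_ik; rewrite -cmpP => /orP[//|ki].
  have /subsetP/(_ k) := pred_sub _ _ (sP _ _ ik); rewrite !inE => /(_ ki).
  by rewrite (negPf (irr k)).
have /subsetP/(_ i) := pred_sub _ _ (sP _ _ kj); rewrite !inE => sub /sub ltij.
by have := cmpP i j; rewrite ltij /far ij andbF.
Qed.

(** A path that avoids the neighbors of v stays on one side of v in a weakly
    closed labeling. For an asteroidal triple this fails for the middle
    label. *)
Lemma weakly_closed_AT_free n (G : sgraph 'I_n) : weakly_closed G -> AT_free G.
Proof.
case=> s wcs a b c [abc [ab bc ca]].
have sym x y : G x y -> G y x by rewrite adj_sym.
have neq t u : t != u -> (s t : nat) != s u.
  by apply: contraNneq => /ord_inj/perm_inj->.
have same v u w : u != v -> connected_avoiding G (neighborhood G v) u w ->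
    (s u < s v) = (s w < s v).
  move=> uv [q [qu _ <-]]; elim: q u uv qu => //= z q IHq u uv /andP[uz qz].
  rewrite !inE /= => /and3P[uv' zv' Nq].
  have zv : z != v by apply: contra uv' => /eqP <-.
  rewrite -(IHq z) //=; last by rewrite !inE zv'.
  case: (ltngtP (s u) (s v)) (neq _ _ uv) => // hu _;
    case: (ltngtP (s z) (s v)) (neq _ _ zv) => // hz _.
    by case: (wcs _ _ _ uz hu hz) => [|/sym]; rewrite ?(negPf uv') ?(negPf zv').
  by case: (wcs _ _ _ (sym _ _ uz) hz hu) => [|/sym]; rewrite ?(negPf uv') ?(negPf zv').
move: abc; rewrite /= !inE negb_or andbT => /andP[/andP[nab nac] nbc].
have := same _ _ _ nac ab; have := same _ _ _ _ bc; have := same _ _ _ _ ca.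
rewrite [c == b]eq_sym [b == a]eq_sym nbc nab => /(_ isT) h1 /(_ isT) h2 h3.
have := (neq _ _ nab); have := (neq _ _ nac); have := (neq _ _ nbc).
move: h1 h2 h3; lia.
Qed.

Import Order.TTheory GRing.Theory.
Local Open Scope ring_scope.
Local Open Scope quotient_scope.

(** * Two consequences of the definition of F-purity *)

Section QuotientModule.
Variables (A : comNzRingType) (V : lmodType A) (S : V -> Prop).

Definition quot_mod : Type := {ideal_quot (submod_gen S)}.
HB.instance Definition _ := GRing.Zmodule.on quot_mod.

Definition quot_proj (v : V) : quot_mod := \pi_({ideal_quot (submod_gen S)}) v.

Lemma quot_projP u v : (quot_proj u = quot_proj v) <-> (u - v \in submod_gen S).
Proof.
rewrite /quot_proj Quotient.idealrBE.
by split=> [->|/eqP]; first exact: eqxx.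
Qed.

Lemma quot_projD : {morph quot_proj : u v / u + v}.
Proof. by move=> u v; apply: (raddfD \pi_({ideal_quot (submod_gen S)})). Qed.

Definition quot_repr (x : quot_mod) : V := repr (x : {ideal_quot (submod_gen S)}).

Lemma quot_reprK : cancel quot_repr quot_proj.
Proof. by move=> x; apply: reprK. Qed.

Definition quot_scale (a : A) (x : quot_mod) := quot_proj (a *: quot_repr x).

Lemma quot_scale_proj a v : quot_scale a (quot_proj v) = quot_proj (a *: v).
Proof.
apply/quot_projP; rewrite -scalerBr; apply: submod_gen_scale.
by apply/quot_projP; rewrite quot_reprK.
Qed.

Lemma quot_scaleA a b x : quot_scale a (quot_scale b x) = quot_scale (a * b) x.
Proof. by rewrite -[x]quot_reprK !quot_scale_proj scalerA. Qed.
Lemma quot_scale1 : left_id 1 quot_scale.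
Proof. by move=> x; rewrite -[x]quot_reprK quot_scale_proj scale1r. Qed.
Lemma quot_scaleDr : right_distributive quot_scale +%R.
Proof.
move=> a x y; rewrite -[x]quot_reprK -[y]quot_reprK.
by rewrite -quot_projD !quot_scale_proj -quot_projD scalerDr.
Qed.
Lemma quot_scaleDl x : {morph quot_scale^~ x : a b / a + b}.
Proof.
by move=> a b; rewrite -[x]quot_reprK !quot_scale_proj -quot_projD scalerDl.
Qed.

HB.instance Definition _ := GRing.Zmodule_isLmodule.Build A quot_mod
  quot_scaleA quot_scale1 quot_scaleDr quot_scaleDl.

Lemma quot_projZ a v : quot_proj (a *: v) = a *: quot_proj v.
Proof. by rewrite -quot_scale_proj. Qed.

Lemma quot_proj0 : quot_proj 0 = 0.
Proof. exact: (raddf0 \pi_({ideal_quot (submod_gen S)})). Qed.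
End QuotientModule.

Section TensorCalculus.
Variables (A : comNzRingType) (M N : lmodType A).
Implicit Types (m : M) (n : N).

Lemma tensDl m m' n : (m + m') ⊗ n = m ⊗ n + m' ⊗ n.
Proof.
rewrite -tens_projD; apply/tens_projP; rewrite opprD addrA.
exact/submod_gen_incl/TensorDl.
Qed.

Lemma tens0l n : (0 : M) ⊗ n = 0.
Proof. by apply: (addrI (0 ⊗ n)); rewrite -tensDl !addr0. Qed.

Lemma tens_suml I (r : seq I) (F : I -> M) n :
  (\sum_(i <- r) F i) ⊗ n = \sum_(i <- r) F i ⊗ n.
Proof. by apply: (big_morph (fun m => m ⊗ n)) => [? ?|]; rewrite ?tensDl ?tens0l. Qed.

(** The form in which scalars are moved into the pushforward of A, where they
    act by their p-th powers. *)
Lemma tensZ a m n : (a *: m) ⊗ n = m ⊗ (a *: n).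
Proof.
have Zl : (a *: m) ⊗ n = tens_proj (a *: << (m, n) >>).
  exact/tens_projP/submod_gen_incl/TensorZl.
by rewrite Zl; apply/esym/tens_projP/submod_gen_incl/TensorZr.
Qed.
End TensorCalculus.

Section FPurity.
Variables (A : comNzRingType) (p : nat) (pcharAp : p \in [pchar A]).
Local Notation FA := (Fpush pcharAp).

(** A retraction phi of Frobenius gives the retraction m (x) s |-> phi(s) m of
    the map induced by Frobenius on each module. *)
Lemma F_pure_of_retraction (phi : A -> A) :
    {morph phi : x y / x - y} -> (forall r s, phi (r ^+ p * s) = r * phi s) ->
    phi 1 = 1 -> F_pure pcharAp.
Proof.
move=> phiB phiZ phi1 M.
have phi0 : phi 0 = 0 by rewrite -{1}(subrr 0) phiB subrr.
have phiD x y : phi (x + y) = phi x + phi y.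
  by rewrite -[y in LHS]opprK phiB -[- y]sub0r phiB phi0 sub0r opprK.
pose ev (mn : M * FA) : M := phi mn.2 *: mn.1.
have liftB := lift_is_additive ev.
have lift0 : fglift ev 0 = 0 by rewrite -{1}(subrr 0) liftB subrr.
have liftD x y : fglift ev (x + y) = fglift ev x + fglift ev y.
  by rewrite -[y in LHS]opprK liftB -[- y]sub0r liftB lift0 sub0r opprK.
have lift_sum I (r : seq I) F :
    fglift ev (\sum_(i <- r) F i) = \sum_(i <- r) fglift ev (F i).
  exact: (big_morph _ liftD lift0).
have liftZ a x : fglift ev (a *: x) = a *: fglift ev x.
  have -> : a *: x = fgscale a x by [].
  rewrite /fgscale lift_sum -[in RHS](freeg_sumE x) lift_sum.
  by rewrite scaler_sumr; apply: eq_bigr => i _; rewrite !liftU -scalerA.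
have kill x : x \in submod_gen (@tensor_rel A M FA) -> fglift ev x = 0.
  case/asboolP=> s [sS ->]; rewrite lift_sum big_seq big1 // => c /sS cS.
  rewrite liftZ; suff -> : fglift ev c.2 = 0 by rewrite scaler0.
  case: cS => [m m' n|m n n'|a m n|a m n]; rewrite ?liftB ?liftZ !liftU !scale1r /ev /=.
  - by rewrite scalerDr -addrA -opprD subrr.
  - by rewrite phiD scalerDl -addrA -opprD subrr.
  - by rewrite !scalerA mulrC subrr.
  - by rewrite phiZ scalerA subrr.
move=> m m' /tens_projP/kill.
rewrite liftB !liftU !scale1r /ev /= /Frob pFrobenius_aut1 phi1 !scale1r.
by move/eqP; rewrite subr_eq0 => /eqP.
Qed.

(** The system h x = b is solvable if and only if b vanishes in the cokernel of
    h : A -> A^m. After base change along Frobenius the system has the solution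
    q, so that b (x) 1 vanishes; purity for the cokernel concludes. *)
Lemma F_pure_linear_system m (h b : 'rV[A]_m) (q : A) : F_pure pcharAp ->
    (forall i, h 0 i ^+ p * q = b 0 i ^+ p) ->
  exists x, forall i, h 0 i * x = b 0 i.
Proof.
move=> FpA hq; pose S (v : 'rV[A]_m) := v = h.
pose e i : quot_mod S := quot_proj S (delta_mx 0 i).
have projE v : quot_proj S v = \sum_i v 0 i *: e i.
  rewrite [in LHS](row_sum_delta v).
  rewrite (big_morph _ (@quot_projD _ _ S) (@quot_proj0 _ _ S)).
  by apply: eq_bigr => i _; rewrite quot_projZ.
have b0 : quot_proj S b = quot_proj S 0.
  apply: FpA; rewrite quot_proj0 tens0l projE tens_suml.
  transitivity (quot_proj S h ⊗ (q : FA)).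
    rewrite projE tens_suml; apply: eq_bigr => i _; rewrite !tensZ; congr (_ ⊗ _).
    rewrite /Frob pFrobenius_aut1 /GRing.scale /= /Fpush_scale.
    by rewrite hq mulr1.
  have -> : quot_proj S h = 0.
    by rewrite -(quot_proj0 S); apply/quot_projP; rewrite subr0; apply: submod_gen_incl.
  by rewrite tens0l.
move/quot_projP: b0; rewrite subr0 => /asboolP[s [sS bE]].
exists (\sum_(c <- s) c.1) => i; rewrite bE summxE mulr_sumr big_seq [RHS]big_seq.
by apply: eq_bigr => c /sS ->; rewrite mxE mulrC.
Qed.
End FPurity.

(** * The trace of Frobenius on a polynomial ring *)

Lemma mcoeffMX_notle (k : nzRingType) N (q : {mpoly k[N]}) (m l : 'X_{1..N}) :
  ~~ (m <= l)%MM -> (q * 'X_[m])@_l = 0.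
Proof.
move=> ml; apply/eqP; rewrite mcoeff_eq0 (perm_mem (msuppMX q m)).
by apply: contra ml => /mapP[m' _ ->]; apply: lem_addr.
Qed.

Section Trace.
Variables (p N : nat) (p_pr : prime p).
Local Notation R := {mpoly 'F_p[N]}.
Implicit Types (q r s : R) (m : 'X_{1..N}).

(** The monomials whose exponents are congruent to -1 modulo p are the p-th
    powers times the monomial with all exponents p - 1; these are the ones that
    the trace of Frobenius does not kill. *)
Definition trace_exp m : 'X_{1..N} := [multinom (m i * p + p.-1)%N | i < N].

(** The generator of the module of R-linear maps from the pushforward of R to
    R: the coefficient of the monomial with all exponents p - 1 in the basis of
    monomials with exponents less than p, over the subring of p-th powers. *)
Definition trace q : R :=
  \sum_(m <- msupp q | [forall i, m i %% p == p.-1]%N)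
     q@_m *: 'X_[[multinom (m i %/ p)%N | i < N]].

Lemma mcoeff_trace q m : (trace q)@_m = q@_(trace_exp m).
Proof.
have p_gt0 := prime_gt0 p_pr.
have texpP m' : ([forall i, m' i %% p == p.-1]
    && ([multinom (m' i %/ p) | i < N] == m))%N = (m' == trace_exp m).
  apply/andP/eqP => [[/forallP m'p /eqP <-]|->].
    apply/mnmP => i; rewrite !mnmE -(eqP (m'p i)); exact: divn_eq.
  split; first by apply/forallP => i; rewrite mnmE modnMDl modn_small // ltn_predL.
  by apply/eqP/mnmP => i; rewrite !mnmE divnMDl // divn_small ?addn0 // ltn_predL.
rewrite raddf_sum /= big_mkcond /=.
rewrite (eq_bigr (fun m' => if m' == trace_exp m then q@_m' else 0)).
  have [qm|qm] := boolP (trace_exp m \in msupp q).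
    rewrite (bigD1_seq (trace_exp m)) ?msupp_uniq //= eqxx big1 ?addr0 // => m'.
    by move/negPf->.
  rewrite big_seq big1 ?memN_msupp_eq0 // => m' m'q.
  by case: eqP => // m'E; rewrite -m'E m'q in qm.
move=> m' _; rewrite -texpP; case: forallP => //= _.
by rewrite mcoeffZ mcoeffX; case: eqP => _; rewrite ?mulr1 ?mulr0.
Qed.

Lemma trace0 : trace 0 = 0.
Proof. by apply/mpolyP => m; rewrite mcoeff_trace !mcoeff0. Qed.

Lemma traceD : {morph trace : q r / q + r}.
Proof. by move=> q r; apply/mpolyP => m; rewrite !(mcoeff_trace, mcoeffD). Qed.

Lemma traceB : {morph trace : q r / q - r}.
Proof. by move=> q r; apply/mpolyP => m; rewrite !(mcoeff_trace, mcoeffB). Qed.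

Lemma traceZ c q : trace (c *: q) = c *: trace q.
Proof. by apply/mpolyP => m; rewrite !(mcoeff_trace, mcoeffZ). Qed.

Lemma trace_mulXp m q : trace ('X_[m *+ p] * q) = 'X_[m] * trace q.
Proof.
apply/mpolyP => l; rewrite mcoeff_trace mulrC [RHS](congr1 (mcoeff l) (mulrC _ _)).
have [ml|ml] := boolP (m <= l)%MM.
  have -> : trace_exp l = ((m *+ p) + trace_exp (l - m))%MM.
    apply/mnmP => i; rewrite !(mnmE, mulmnE, mnmDE, mnmBE).
    by rewrite addnA -mulnDl subnKC //; apply/mnm_lepP.
  by rewrite mcoeffMX -{2}(submK ml) addmC mcoeffMX mcoeff_trace.
rewrite !mcoeffMX_notle //; apply: contra ml => /mnm_lepP ml; apply/mnm_lepP => i.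
have := ml i; rewrite !(mnmE, mulmnE) => mli; rewrite -ltnS.
rewrite -(ltn_pmul2r (prime_gt0 p_pr)); apply: leq_ltn_trans mli _.
by rewrite mulSn addnC ltn_add2r ltn_predL prime_gt0.
Qed.

(** Raising to the power p fixes the coefficients, which are in the prime
    field, so it suffices that the trace is additive and compatible with the
    p-th powers of monomials. *)
Lemma trace_mulp r q : trace (r ^+ p * q) = r * trace q.
Proof.
have pR : p \in [pchar R].
  rewrite inE p_pr /=; suff -> : p%:R = 0 :> R by rewrite eqxx.
  by rewrite -mpolyC_nat (pcharf0 (pchar_Fp p_pr)) mpolyC0.
rewrite -(pFrobenius_autE pR) [X in pFrobenius_aut pR X]mpolyE rmorph_sum.
rewrite mulr_suml (big_morph _ traceD trace0).
rewrite [X in X * trace q]mpolyE mulr_suml; apply: eq_bigr => m _ /=.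
rewrite pFrobenius_autE exprZn -scalerAl traceZ -scalerAl; congr (_ *: _).
  by have := expf_card r@_m; rewrite (card_Fp p_pr).
by rewrite mpolyXn trace_mulXp.
Qed.
End Trace.

Section IdealMembership.
Variables (R : comNzRingType) (S : R -> Prop).

Lemma ideal_gen_incl a : S a -> a \in ideal_gen S.
Proof. exact: (@submod_gen_incl R R^o). Qed.

Lemma ideal_gen0 : 0 \in ideal_gen S.
Proof. by have [] := submod_gen_zmod_closed (S : R^o -> Prop). Qed.

Lemma ideal_genB a b : a \in ideal_gen S -> b \in ideal_gen S -> a - b \in ideal_gen S.
Proof. by have [_ SB] := submod_gen_zmod_closed (S : R^o -> Prop); apply: SB. Qed.

Lemma ideal_genD a b : a \in ideal_gen S -> b \in ideal_gen S -> a + b \in ideal_gen S.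
Proof.
move=> Sa Sb; rewrite -[b]opprK; apply: ideal_genB => //.
by rewrite -sub0r; apply: ideal_genB; rewrite ?ideal_gen0.
Qed.

Lemma ideal_genM a b : b \in ideal_gen S -> a * b \in ideal_gen S.
Proof. exact: (@submod_gen_scale R R^o). Qed.

Lemma ideal_gen_ind (P : R -> Prop) : P 0 -> (forall a b, P a -> P b -> P (a + b)) ->
  (forall a b, S b -> P (a * b)) -> forall a, a \in ideal_gen S -> P a.
Proof.
move=> P0 PD PM a /asboolP[s [sS ->]]; rewrite big_seq.
by elim/big_ind: _ => // c /sS; apply: PM.
Qed.
End IdealMembership.

Section Fedder.
Variables (n p : nat) (p_pr : prime p) (G : sgraph 'I_n).
Local Notation R := {mpoly 'F_p[n + n]}.
Local Notation J := (@JG 'F_p n G).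

(** Generators of the Frobenius power of the binomial edge ideal. *)
Definition frobenius_edge (g : R) : Prop := exists i j, G i j /\ g = fbin 'F_p i j ^+ p.

(** The sufficient half of Fedder's criterion: s |-> Tr (F s) / c maps J into
    itself, for F J lies in the Frobenius power of J and Tr (g ^+ p * s) = g Tr
    s. *)
Lemma F_pure_of_trace (F : R) (c : 'F_p) :
    (forall i j, G i j -> F * fbin 'F_p i j \in ideal_gen frobenius_edge) ->
    trace F = c%:MP -> c != 0 ->
  RG_F_pure_in_char G p_pr.
Proof.
move=> FJ trF c0; pose phi (s : R) : R := c^-1 *: trace (F * s).
have phiB s t : phi (s - t) = phi s - phi t by rewrite /phi mulrBr traceB // scalerBr.
have phiJ s : s \in J -> phi s \in J.
  have FsJ : s \in J -> F * s \in ideal_gen frobenius_edge.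
    elim/ideal_gen_ind => [|a b Fa Fb|a _ [i [j [ij ->]]]].
    - by rewrite mulr0 ideal_gen0.
    - by rewrite mulrDr; apply: ideal_genD.
    - by rewrite mulrCA; apply/ideal_genM/FJ.
  move/FsJ; rewrite /phi -mul_mpolyC => Fs; apply: ideal_genM.
  elim/ideal_gen_ind: Fs => [|a b Ja Jb|a _ [i [j [ij ->]]]].
  - by rewrite trace0 // ideal_gen0.
  - by rewrite traceD //; apply: ideal_genD.
  - rewrite mulrC trace_mulp // mulrC; apply/ideal_genM/ideal_gen_incl.
    by exists i, j.
pose pr (s : R) : RG 'F_p G := \pi_({ideal_quot J}) s.
pose re (a : RG 'F_p G) : R := repr (a : {ideal_quot J}).
have prB s t : pr (s - t) = pr s - pr t by apply: (rmorphB \pi_({ideal_quot J})).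
have prM s t : pr (s * t) = pr s * pr t by apply: (rmorphM \pi_({ideal_quot J})).
have prX s : pr (s ^+ p) = pr s ^+ p by apply: (rmorphXn \pi_({ideal_quot J})).
have pr1 : pr 1 = 1 by apply: (rmorph1 \pi_({ideal_quot J})).
have reK a : pr (re a) = a by apply: reprK.
have prP s t : pr s = pr t -> s - t \in J.
  by rewrite /pr Quotient.idealrBE => ->; rewrite eqxx.
have prE s t : s - t \in J -> pr s = pr t.
  by rewrite /pr Quotient.idealrBE => /eqP.
pose psi a := pr (phi (re a)).
have psi_pr s : psi (pr s) = pr (phi s).
  by apply: prE; rewrite -phiB; apply/phiJ/prP/reK.
apply: (@F_pure_of_retraction _ _ _ psi).
- by move=> a b; rewrite -[a]reK -[b]reK -prB !psi_pr phiB prB.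
- move=> a b; rewrite -[a]reK -[b]reK -prX -prM !psi_pr -prM /phi mulrCA trace_mulp //.
  by rewrite scalerAr.
- by rewrite -pr1 psi_pr /phi mulr1 trF -mul_mpolyC -mpolyCM mulVf.
Qed.
End Fedder.

(** * Splitting the Frobenius of an interval graph *)

(** The minors of a 2 x N matrix with rows X and Y, in an arbitrary commutative
    ring. With e = p - 1, the exponent e.+1 is p. *)
Section ChainOfMinors.
Variables (R : comNzRingType) (S : R -> Prop) (X Y : nat -> R).
Local Notation I := (ideal_gen S).
Definition minor s t := X s * Y t - X t * Y s.

Variables (e i : nat).
Let P j := \prod_(i <= t < j) minor t t.+1 ^+ e.

(** Induction on j, where w = a X_(i+1) + b Y_(i+1) changes at each step. Put f
    = minor (i+1) j, g = minor (i+1) (j+1) and h = minor j (j+1). By the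
    Pluecker relation w h is a combination a' g - b' f of g and f; so (w f)^e
    h^e is f^e a'^e g^e modulo f^(e+1), which is in the ideal, and f is the
    next w. *)
Lemma chain_reduce j : (i.+1 < j)%N ->
    (forall k, (i.+1 < k < j)%N -> minor i.+1 k ^+ e.+1 \in I) ->
  exists a b c, P j - c * ((a * X i.+1 + b * Y i.+1) * minor i.+1 j) ^+ e \in I.
Proof.
elim: j => // j IHj; rewrite ltnS leq_eqVlt => /predU1P[<- _|ij adm].
  exists (- Y i), (X i), 1; rewrite /P !big_nat_recr //= big_geq // !mul1r.
  rewrite -exprMn; set u := _ ^+ e; set v := _ ^+ e.
  suff -> : u = v by rewrite subrr ideal_gen0.
  by congr (_ ^+ e); rewrite /minor; ring.
have [|a [b [c Pj]]] := IHj ij.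
  by move=> k /andP[ik kj]; apply: adm; rewrite ik ltnW.
set f := minor i.+1 j in Pj *; set g := minor i.+1 j.+1; set h := minor j j.+1.
pose w := a * X i.+1 + b * Y i.+1.
pose a' := a * X j + b * Y j; pose b' := a * X j.+1 + b * Y j.+1.
have wh : w * h = a' * g - b' * f by rewrite /w /h /a' /g /b' /f /minor; ring.
exists (Y j), (- X j), (c * a' ^+ e).
have -> : Y j * X i.+1 + - X j * Y i.+1 = f by rewrite /f /minor; ring.
have fI : f ^+ e.+1 \in I by apply: adm; rewrite ij /=.
have PE : P j.+1 = P j * h ^+ e by rewrite /P big_nat_recr // ltnW // ltnW.
have [q qE] : exists q, (w * f * h) ^+ e - (f * (a' * g)) ^+ e = q * f ^+ e.+1.
  have -> : w * f * h = f * (a' * g - b' * f) by rewrite -wh; ring.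
  rewrite [(f * (_ - _)) ^+ e]exprMn [(f * (a' * g)) ^+ e]exprMn -mulrBr subrXX.
  set q := \sum_(_ < _) _; exists (- b' * q); rewrite exprS; ring.
have -> : P j.+1 - c * a' ^+ e * (f * g) ^+ e =
    h ^+ e * (P j - c * (w * f) ^+ e) + c * q * f ^+ e.+1.
  by rewrite PE -[c * q * _]mulrA -qE !exprMn; ring.
by apply: ideal_genD; apply: ideal_genM.
Qed.

(** The reduced form of the product contains the factor minor (i+1) j to the
    power e; one more factor brings it into the ideal. *)
Lemma chain_annihilates j : (i.+1 < j)%N ->
    (forall k, (i.+1 < k <= j)%N -> minor i.+1 k ^+ e.+1 \in I) ->
  P j * minor i.+1 j \in I.
Proof.
move=> ij adm; have [|a [b [c Pj]]] := chain_reduce ij.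
  by move=> k /andP[ik kj]; apply: adm; rewrite ik ltnW.
set f := minor i.+1 j in Pj *; set w := a * _ + _ in Pj.
have -> : P j * f = f * (P j - c * (w * f) ^+ e) + c * w ^+ e * f ^+ e.+1.
  by rewrite exprMn exprS; ring.
by apply: ideal_genD; apply: ideal_genM => //; apply: adm; rewrite ij leqnn.
Qed.
End ChainOfMinors.

Section Padding.
Variables (T : Type) (n : nat) (a b : T) (u : 'I_n -> T).

(** Positions 0 and n + 1 receive boundary values. With the column (1, 0) in
    front and (0, 1) at the end, the variables y and x that open and close the
    product over a vertex order become minors like the others. *)
Definition padded t := if t is t'.+1 then oapp u b (insub t') else a.

Lemma padded_ord (i : 'I_n) : padded i.+1 = u i.
Proof. by rewrite /padded valK. Qed.

Lemma padded_last : padded n.+1 = b.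
Proof. by rewrite /padded insubF ?ltnn. Qed.
End Padding.

Section LeadingMonomial.
Variables (k : fieldType) (n : nat).
Local Notation R := {mpoly k[n + n]}.

Definition xpad (v : 'I_n -> 'I_n) := padded 1 0 (fun i => xvar k (v i)).
Definition ypad (v : 'I_n -> 'I_n) := padded 0 1 (fun i => yvar k (v i)).
Definition chain (v : 'I_n -> 'I_n) : R :=
  \prod_(0 <= t < n.+1) minor (xpad v) (ypad v) t t.+1.

Definition ones : 'X_{1..n + n} := [multinom 1%N | i < n + n].

Let xmon := padded 0%MM 0%MM (fun i : 'I_n => U_(lshift n i)%MM).
Let ymon := padded 0%MM 0%MM (fun i : 'I_n => U_(rshift n i)%MM).

Lemma lshift_mnm1 (i j : 'I_n) : U_(lshift n i)%MM (lshift n j) = (i == j) :> nat.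
Proof. by rewrite mnm1E (inj_eq (@lshift_inj _ _)). Qed.
Lemma rshift_mnm1 (i j : 'I_n) : U_(rshift n i)%MM (rshift n j) = (i == j) :> nat.
Proof. by rewrite mnm1E (inj_eq (@rshift_inj _ _)). Qed.
Lemma lrshift_mnm1 (i j : 'I_n) : U_(lshift n i)%MM (rshift n j) = 0%N.
Proof. by rewrite mnm1E eq_lrshift. Qed.
Lemma rlshift_mnm1 (i j : 'I_n) : U_(rshift n i)%MM (lshift n j) = 0%N.
Proof. by rewrite mnm1E eq_rlshift. Qed.

Lemma xpad_id t : (t <= n)%N -> xpad id t = 'X_[xmon t].
Proof.
case: t => [|t] tn; rewrite /xpad /xmon /padded ?mpolyX0 //.
by rewrite (insubT (fun t => (t < n)%N) tn).
Qed.

Lemma ypad_id t : (0 < t)%N -> ypad id t = 'X_[ymon t].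
Proof.
case: t => // t _; rewrite /ypad /ymon /padded.
by case: insubP => [i _ _ //|_]; rewrite /= mpolyX0.
Qed.

(** In the order with x_1 > ... > x_n > y_1 > ... > y_n, the first term of each
    minor of consecutive columns dominates. *)
Lemma mlead_minor t : (t < n.+1)%N ->
  let f := minor (xpad id) (ypad id) t t.+1 in
  f != 0 /\ mlead f = (xmon t + ymon t.+1)%MM.
Proof.
rewrite ltnS => tn f; have lead : xpad id t * ypad id t.+1 = 'X_[xmon t + ymon t.+1].
  by rewrite xpad_id // ypad_id // mpolyXD.
case: (posnP t) => [t0|t_gt0].
  have fE : f = 'X_[xmon t + ymon t.+1].
    by rewrite -lead /f /minor t0 /ypad /= mulr0 subr0.
  by rewrite fE mleadXm -msupp_eq0 msuppX.
have [tn1|nt] := ltnP t n; last first.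
  have fE : f = 'X_[xmon t + ymon t.+1].
    rewrite -lead /f /minor.
    have -> : xpad id t.+1 = 0.
      by have -> : t = n; [apply/eqP; rewrite eqn_leq tn | apply: padded_last].
    by rewrite mul0r subr0.
  by rewrite fE mleadXm -msupp_eq0 msuppX.
have fE : f = 'X_[xmon t + ymon t.+1] - 'X_[xmon t.+1 + ymon t].
  by rewrite /f /minor lead (xpad_id tn1) (ypad_id t_gt0) -mpolyXD.
have lt_m : ((xmon t.+1 + ymon t)%MM < (xmon t + ymon t.+1)%MM)%O.
  case: t t_gt0 {tn} tn1 {lead f fE} => // t _ tn1.
  have tn := ltnW tn1; rewrite /xmon /ymon /padded !(insubT (fun t => (t < n)%N)) /=.
  set i := Sub t tn : 'I_n; set i' := Sub t.+1 tn1 : 'I_n.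
  apply/ltmcP; first by rewrite !mdegD !mdeg1.
  exists (lshift n i) => [j|].
    rewrite -[j]splitK; case: (split j) => l /=; last by rewrite ltnNge ltnW // ltn_addr.
    move=> li; rewrite !mnmDE !lshift_mnm1 !rlshift_mnm1 -!val_eqE /=.
    by rewrite (gtn_eqF li) gtn_eqF // ltnW.
  by rewrite !mnmDE !lshift_mnm1 !rlshift_mnm1 -!val_eqE /= eqxx gtn_eqF.
have lead_f : mlead f = (xmon t + ymon t.+1)%MM.
  by rewrite fE mleadDl ?mleadN !mleadXm.
split=> //; apply: contra_eqN lead_f => /eqP f0; apply/eqP => _.
have /eqP := congr1 (mcoeff (xmon t + ymon t.+1)%MM) f0.
by rewrite fE mcoeffB !mcoeffX eqxx (lt_eqF lt_m) subr0 mcoeff0 oner_eq0.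
Qed.

(** Each x occurs in the leading term of exactly one minor, and so does each
    y. *)
Lemma mlead_chain : chain id != 0 /\ mlead (chain id) = ones.
Proof.
split.
  rewrite /chain prodf_seq_neq0; apply/allP => t.
  by rewrite mem_index_iota => /andP[_ /mlead_minor[]].
rewrite /chain big_seq mlead_prod => [|t _]; last first.
  by rewrite mem_index_iota => /andP[_ /mlead_minor[]].
rewrite (eq_bigr (fun t => xmon t + ymon t.+1)%MM) => [|t]; last first.
  by rewrite mem_index_iota => /andP[_ /mlead_minor[]].
rewrite -big_seq; apply/mnmP => j; rewrite mnm_sumE mnmE.
under eq_bigr do rewrite mnmDE.
have -> : (\sum_(0 <= t < n.+1) (xmon t j + ymon t.+1 j))%N =
    (\sum_(i < n) U_(lshift n i)%MM j + \sum_(i < n) U_(rshift n i)%MM j)%N.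
  rewrite big_split; congr (_ + _)%N.
    rewrite big_nat_recl // big_mkord /xmon /= mnm0E add0n.
    by apply: eq_bigr => i _; rewrite valK.
  rewrite big_nat_recr // big_mkord /= insubF ?ltnn // mnm0E addn0.
  by apply: eq_bigr => i _; rewrite valK.
rewrite -[j]splitK; case: (split j) => l /=.
  rewrite [X in (_ + X)%N]big1 => [|i _]; last exact: rlshift_mnm1.
  rewrite (bigD1 l) //= big1 => [|i il]; rewrite lshift_mnm1 ?eqxx //.
  by rewrite (negPf il).
rewrite [X in (X + _)%N]big1 => [|i _]; last exact: lrshift_mnm1.
rewrite (bigD1 l) //= big1 => [|i il]; rewrite rshift_mnm1 ?eqxx //.
by rewrite (negPf il).
Qed.
End LeadingMonomial.

Section Splitting.
Variables (p n : nat) (p_pr : prime p).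

(** The only exponents of F that are congruent to -1 modulo p are those of its
    leading monomial: others of this form have larger degree. *)
Lemma trace_chain_id : let F := chain 'F_p (@id 'I_n) ^+ p.-1 in
  F@_(trace_exp p 0%MM) != 0 /\
  forall m, m != 0%MM -> F@_(trace_exp p m) = 0.
Proof.
have [chain0 lead_chain] := mlead_chain 'F_p n.
have leadF : mlead (chain 'F_p id ^+ p.-1) = trace_exp p (0%MM : 'X_{1..n + n}).
  by rewrite mleadX // lead_chain; apply/mnmP => i; rewrite mulmnE !mnmE mul0n mul1n.
split=> [|m m0].
  by rewrite -leadF mleadc_eq0 expf_eq0 negb_and chain0 orbT.
apply: mcoeff_gt_mlead; rewrite leadF; apply: lt_mdeg_ltmc.
have -> : trace_exp p m = (m *+ p + trace_exp p 0)%MM.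
  by apply/mnmP => i; rewrite mnmDE mulmnE !mnmE mul0n.
by rewrite mdegD mdegMn -[ltnLHS]add0n ltn_add2r muln_gt0 lt0n mdeg_eq0 m0 prime_gt0.
Qed.

Variable s : {perm 'I_n}.

(** Arbitrary vertex orders are reduced to the identity by permuting the
    variables, since the monomial order is tied to the indices. *)
Definition on_both (i : 'I_(n + n)) : 'I_(n + n) :=
  unsplit (match split i with inl j => inl (s j) | inr j => inr (s j) end).

Lemma on_both_inj : injective on_both.
Proof.
move=> i j /(can_inj (@unsplitK _ _)) eq_ij; apply: (can_inj (@splitK _ _)).
by move: eq_ij; case: (split i) (split j) => [a|a] [b|b] // [/perm_inj->].
Qed.

Lemma msym_chain (k : fieldType) :
  msym (perm on_both_inj) (chain k (@id 'I_n)) = chain k s.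
Proof.
have dl i : on_both (lshift n i) = lshift n (s i).
  by rewrite /on_both -[lshift n i]/(unsplit (inl i)) unsplitK.
have dr i : on_both (rshift n i) = rshift n (s i).
  by rewrite /on_both -[rshift n i]/(unsplit (inr i)) unsplitK.
have symX i : msym (perm on_both_inj) ('X_i : {mpoly k[n + n]}) = 'X_(on_both i).
  by rewrite /msym mmapX mmap1U permE.
pose sy := msym (perm on_both_inj) : {rmorphism {mpoly k[n + n]} -> {mpoly k[n + n]}}.
have symx t : sy (xpad k id t) = xpad k s t.
  case: t => [|t]; first exact: rmorph1.
  by rewrite /xpad /=; case: insubP => [i _ _|_] /=; [rewrite symX dl | exact: rmorph0].
have symy t : sy (ypad k id t) = ypad k s t.
  case: t => [|t]; first exact: rmorph0.
  by rewrite /ypad /=; case: insubP => [i _ _|_] /=; [rewrite symX dr | exact: rmorph1].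
rewrite -[LHS]/(sy _) /chain rmorph_prod; apply: eq_bigr => t _.
by rewrite /minor rmorphB !rmorphM !symx !symy.
Qed.

Lemma trace_chain : let F := chain 'F_p s ^+ p.-1 in
  exists2 c, c != 0 & trace F = c%:MP.
Proof.
have [c0 cm] := trace_chain_id; rewrite -msym_chain; set F := chain _ id ^+ _ in c0 cm.
exists F@_(trace_exp p 0%MM) => //; apply/mpolyP => m.
rewrite mcoeff_trace // -rmorphXn /= mcoeff_sym mcoeffC -/F.
have -> : [multinom trace_exp p m (perm on_both_inj i) | i < n + n] =
   trace_exp p [multinom m (perm on_both_inj i) | i < n + n].
  by apply/mnmP => i; rewrite !mnmE.
have [->|m0] := eqVneq m 0%MM.
  rewrite mulr1; congr (F@_(trace_exp p _)); apply/mnmP => i; by rewrite !mnmE.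
rewrite mulr0 cm //; apply: contra m0 => /eqP/mnmP sm0; apply/eqP/mnmP => i.
by have := sm0 ((perm on_both_inj)^-1 i)%g; rewrite !mnmE permKV.
Qed.
End Splitting.

(** For an edge from i to a later j, all the minors of i with a vertex up to j
    come from edges, so the factors of F from the position of i to that of j
    already carry the binomial of the edge into the Frobenius power. *)
Theorem F_pure_of_interval_labeling n (G : sgraph 'I_n) s p (p_pr : prime p) :
  interval_labeling G s -> RG_F_pure_in_char G p_pr.
Proof.
move=> Gs; pose v := (s^-1)%g; have [c c0 trF] := trace_chain p_pr v.
apply: F_pure_of_trace trF c0 => i j.
pose e := p.-1; have pE : e.+1 = p by rewrite prednK ?prime_gt0.
wlog lt_ij : i j / (s i < s j)%N => [th ij|ij].
  case: (ltngtP (s i) (s j)) => [lt_ij|lt_ji|/val_inj/perm_inj eq_ij].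
  - exact: th.
  - have -> : fbin 'F_p i j = -1 * fbin 'F_p j i by rewrite /fbin; ring.
    by rewrite mulrCA; apply: ideal_genM; apply: th; rewrite 1?adj_sym.
  - by move: ij; rewrite eq_ij adj_irrefl.
pose X := xpad 'F_p v; pose Y := ypad 'F_p v.
have fbinE a b : fbin 'F_p a b = minor X Y (s a).+1 (s b).+1.
  by rewrite /minor /X /Y /xpad /ypad !padded_ord !permK.
have PI : (\prod_(s i <= t < (s j).+1) minor X Y t t.+1 ^+ e) * fbin 'F_p i j
    \in ideal_gen (frobenius_edge G).
  rewrite fbinE; apply: chain_annihilates => // -[//|k] /andP[ik kj].
  have kn : (k < n)%N by apply: leq_trans kj _.
  pose w := (s^-1)%g (Ordinal kn).
  have sw : s w = k :> nat by rewrite /w permKV.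
  rewrite pE -sw -fbinE; apply: ideal_gen_incl; exists i, w; split=> //.
  move: ik kj; rewrite -sw !ltnS [(s w <= s j)%N]leq_eqVlt => ik.
  case/predU1P=> [/val_inj/perm_inj->//|wj].
  exact: Gs ij ik wj.
have le_ij : (s i <= (s j).+1)%N by rewrite leqW // ltnW.
have le_jn : ((s j).+1 <= n.+1)%N by rewrite ltnS ltnW.
rewrite /chain -prodrXl (big_cat_nat (leq0n (s i)) (leq_trans le_ij le_jn)).
rewrite (big_cat_nat le_ij le_jn) /=.
rewrite -/e -/X -/Y; set A := \prod_(_ <= _ < s i) _; set B := \prod_(_.+1 <= _ < _) _.
set P := \prod_(_ <= _ < _) _ in PI *.
have -> : A * (P * B) * fbin 'F_p i j = A * B * (P * fbin 'F_p i j) by ring.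
exact: ideal_genM.
Qed.

(** * Asteroidal triples obstruct F-purity *)

Section MonomialMaps.
Variables (k : fieldType) (N : nat) (keep : pred 'I_N) (g : 'I_N -> 'X_{1..N}).
Local Notation R := {mpoly k[N]}.

Definition monomial_map : {rmorphism R -> R} :=
  mmap (@mpolyC N k) (fun i => if keep i then 'X_[g i] else 0 : R).

Definition kept (m : 'X_{1..N}) := [forall i, (m i != 0%N) ==> keep i].
Definition monomial_image (m : 'X_{1..N}) := (\sum_(i < N) g i *+ m i)%MM.

Lemma monomial_mapX m :
  monomial_map 'X_[m] = if kept m then 'X_[monomial_image m] else 0.
Proof.
rewrite /monomial_map /= mmapX /mmap1; case: ifP => [/forallP km|/forallPn[i]].
  rewrite /monomial_image -mprodXnE; apply: eq_bigr => i _.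
  have := km i; case: (m i) => [|j] /= ki; first by rewrite !expr0.
  by rewrite ki.
rewrite negb_imply => /andP[mi /negPf ki].
by rewrite (bigD1 i) //= ki expr0n (negPf mi) mul0r.
Qed.

Lemma mcoeff_monomial_map (M : 'X_{1..N}) (s : seq 'X_{1..N}) (q : R) :
    uniq s -> (forall m, kept m && (monomial_image m == M) = (m \in s)) ->
  (monomial_map q)@_M = \sum_(m <- s) q@_m.
Proof.
move=> uniq_s sP; rewrite [q in LHS]mpolyE rmorph_sum raddf_sum /=.
rewrite (eq_bigr (fun m => if m \in s then q@_m else 0)) => [|m _]; last first.
  rewrite -mul_mpolyC rmorphM /= [mmap _ _ _%:MP]mmapC mcoeffCM monomial_mapX -sP.
  case: kept; rewrite ?mcoeff0 ?mulr0 //= mcoeffX.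
  by case: eqP => _; rewrite ?mulr1 ?mulr0.
rewrite -big_mkcond /= [RHS](bigID (mem (msupp q))) /= [X in _ = _ + X]big1 ?addr0.
  rewrite -big_filter -[RHS]big_filter; apply: perm_big; apply: uniq_perm => [||m].
  - exact/filter_uniq/msupp_uniq.
  - exact: filter_uniq.
  - by rewrite !mem_filter andbC.
by move=> m /memN_msupp_eq0.
Qed.
End MonomialMaps.

Section Obstruction.
Variables (k : fieldType) (n : nat) (G : sgraph 'I_n).
Local Notation R := {mpoly k[n + n]}.
Local Notation x := (xvar k).
Local Notation y := (yvar k).
Local Notation f := (fbin k).
Local Notation J := (@JG k n G).

(** Along an edge uw, x_w f_uv = x_u f_wv + x_v f_uw. *)
Lemma path_binomial (u : 'I_n) q : path G u q ->
  (\prod_(w <- q) x w) * f u (last u q) \in J.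
Proof.
elim: q u => [|w q IHq] u /=.
  by move=> _; rewrite /fbin subrr mulr0; apply: ideal_gen0.
case/andP=> uw /IHq Jwq; rewrite big_cons; set P := \prod_(_ <- _) _ in Jwq *.
have -> : x w * P * f u (last w q) =
    x u * (P * f w (last w q)) + x (last w q) * P * f u w.
  by rewrite /fbin; ring.
apply: ideal_genD; apply: ideal_genM => //.
by apply: ideal_gen_incl; exists u, w.
Qed.

Lemma avoiding_binomial S u v : connected_avoiding G S u v ->
  exists q, [/\ all [predC S] q, u \notin S, v \notin S &
                (\prod_(w <- q) x w) * f u v \in J].
Proof.
case=> q [qu _ <- Nq]; case/andP: (Nq) => uS qS; exists q; split=> //.
  exact: (allP Nq _ (mem_last u q)).
exact: path_binomial.
Qed.

(** The variables along the path are fixed by psi, and their product is a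
    nonzero divisor: psi kills J, hence the colon ideal of J by this
    product. *)
Lemma map_kills_colon (psi : {rmorphism R -> R}) (S : {set 'I_n}) q (r : R) :
    (forall u v, G u v -> psi (f u v) = 0) ->
    (forall w, w \notin S -> psi (x w) = x w) ->
    all [predC S] q -> (\prod_(w <- q) x w) * r \in J ->
  psi r = 0.
Proof.
move=> psiG psix qS Jr.
have psiJ s : s \in J -> psi s = 0.
  elim/ideal_gen_ind => [|a b a0 b0|a _ [u [v [uv ->]]]]; first exact: rmorph0.
    by rewrite rmorphD a0 b0 addr0.
  by rewrite rmorphM psiG // mulr0.
have : psi ((\prod_(w <- q) x w) * r) = 0 by apply: psiJ.
rewrite rmorphM rmorph_prod big_seq (eq_bigr (fun w => x w)) => [|w /(allP qS)/psix//].
move/eqP; rewrite mulf_eq0 => /orP[|/eqP//]; rewrite -big_seq prodf_seq_eq0.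
by case/hasP => w _ /=; rewrite /xvar -msupp_eq0 msuppX.
Qed.

Local Notation Ux v := U_(lshift n v)%MM.
Local Notation Uy v := U_(rshift n v)%MM.

(** Setting to zero the variables at neighbors of c and all the y_v with v
    distinct from c kills every edge binomial, and fixes the monomial
    considered. *)
Lemma mcoeff_flat (c a b : 'I_n) q (r : R) :
    a != c -> b != c -> a \notin neighborhood G c -> b \notin neighborhood G c ->
    all [predC neighborhood G c] q -> (\prod_(w <- q) x w) * r \in J ->
  r@_(Ux a + Ux b + Uy c) = 0.
Proof.
move=> ac bc aN bN qN Jr.
pose keep (i : 'I_(n + n)) := match split i with inl v => v \notin neighborhood G c
   | inr v => v == c end.
have keepx v : keep (lshift n v) = (v \notin neighborhood G c).
  by rewrite /keep -[lshift n v]/(unsplit (inl v)) unsplitK.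
have keepy v : keep (rshift n v) = (v == c).
  by rewrite /keep -[rshift n v]/(unsplit (inr v)) unsplitK.
pose psi := monomial_map k keep (fun i => U_(i)%MM).
have psiX i : psi 'X_i = if keep i then 'X_i else 0.
  by rewrite /psi /monomial_map /= mmapX mmap1U.
have psi0 : psi r = 0.
  apply: (map_kills_colon (S := neighborhood G c) _ _ qN Jr) => [u v uv|w wN].
    rewrite /fbin !rmorphB !rmorphM /= /xvar /yvar !psiX !keepx !keepy !inE.
    case: (u =P c) uv => [->|_]; case: (v =P c) => [->|_] uv;
       rewrite ?adj_irrefl ?(adj_sym _ c) ?uv /= ?mulr0 ?mul0r ?subrr //.
    by rewrite adj_sym uv mul0r subrr.
  by rewrite /xvar psiX keepx wN.
have := congr1 (mcoeff (Ux a + Ux b + Uy c)%MM) psi0; rewrite mcoeff0.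
rewrite (@mcoeff_monomial_map _ _ _ _ _ [:: (Ux a + Ux b + Uy c)%MM]) ?big_seq1 // => m.
have -> : monomial_image (fun i => U_(i)%MM) m = m.
  by rewrite /monomial_image [RHS]multinomUE_id.
rewrite inE; case: eqP => [->|_]; rewrite ?andbT ?andbF //.
apply/forallP => i; apply/implyP; rewrite -[i]splitK; case: (split i) => v /=;
  rewrite ?keepx ?keepy !mnmDE ?lshift_mnm1 ?rshift_mnm1 ?lrshift_mnm1 ?rlshift_mnm1.
  by case: (a =P v) => [<- //|_]; case: (b =P v) => [<- //|_].
by rewrite !add0n eqb0 negbK eq_sym.
Qed.

(** Setting to zero y_a and the variables at neighbors of a, and y_v to x_v y_a
    for the other vertices v, kills every edge binomial: the vertices other
    than a become parallel, with y_a as their common slope. The two monomials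
    of the statement are those that become x_a x_b x_c y_a. *)
Lemma mcoeff_parallel (a b c : 'I_n) q (r : R) :
    a != b -> b != c -> a != c ->
    b \notin neighborhood G a -> c \notin neighborhood G a ->
    all [predC neighborhood G a] q -> (\prod_(w <- q) x w) * r \in J ->
  r@_(Ux a + Ux b + Uy c) + r@_(Ux a + Ux c + Uy b) = 0.
Proof.
move=> ab bc ac bN cN qN Jr.
have [ba cb ca] : [/\ b != a, c != b & c != a] by split; rewrite eq_sym.
pose keep (i : 'I_(n + n)) := match split i with inl v => v \notin neighborhood G a
   | inr v => (v != a) && (v \notin neighborhood G a) end.
pose g (i : 'I_(n + n)) : 'X_{1..n + n} := match split i with inl v => Ux v
   | inr v => (Ux v + Uy a)%MM end.
have splx v : split (lshift n v) = inl v.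
  by rewrite -[lshift n v]/(unsplit (inl v)) unsplitK.
have sply v : split (rshift n v) = inr v.
  by rewrite -[rshift n v]/(unsplit (inr v)) unsplitK.
pose psi := monomial_map k keep g.
have psix v : psi (x v) = if v \notin neighborhood G a then x v else 0.
  by rewrite /psi /monomial_map /= mmapX mmap1U /keep /g splx.
have psiy v : psi (y v) = if (v != a) && (v \notin neighborhood G a) then x v * y a else 0.
  by rewrite /psi /monomial_map /= mmapX mmap1U /keep /g sply mpolyXD.
have psi0 : psi r = 0.
  apply: (map_kills_colon (S := neighborhood G a) _ _ qN Jr) => [u v uv|w wN].
    rewrite /fbin !rmorphB !rmorphM !psix !psiy !inE.
    case: (u =P a) uv => [->|_] uv; case: (v =P a) uv => [->|_] uv;
      first by rewrite adj_irrefl in uv.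
    - by rewrite adj_sym uv /= !mul0r mulr0 subrr.
    - by rewrite uv /= !mul0r mulr0 subrr.
    by case: (G u a) => /=; case: (G v a) => /=; rewrite ?mulr0 ?mul0r ?subrr //; ring.
  by rewrite psix wN.
have := congr1 (mcoeff (Ux a + Ux b + Ux c + Uy a)%MM) psi0; rewrite mcoeff0.
set m1 := (_ + Uy c)%MM; set m2 := (_ + Uy b)%MM.
rewrite (@mcoeff_monomial_map _ _ _ _ _ [:: m1; m2]).
- by rewrite !big_cons big_nil addr0.
- rewrite /= inE andbT; apply/eqP => /mnmP/(_ (lshift n b)).
  rewrite !mnmDE !lshift_mnm1 !rlshift_mnm1 eqxx.
  by rewrite (negPf cb) (negPf ab).
move=> m; rewrite !inE.
have imx v : monomial_image g m (lshift n v) = (m (lshift n v) + m (rshift n v))%N.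
  rewrite /monomial_image mnm_sumE big_split_ord /=; congr (_ + _)%N.
    rewrite (bigD1 v) //= big1 => [|w wv];
      rewrite mulmnE /g splx lshift_mnm1 ?eqxx ?mul1n ?addn0 //.
    by rewrite (negPf wv).
  rewrite (bigD1 v) //= big1 => [|w wv];
    rewrite mulmnE /g sply mnmDE lshift_mnm1 rlshift_mnm1 addn0.
    by rewrite eqxx mul1n.
  by rewrite (negPf wv).
have imy v : monomial_image g m (rshift n v) = ((a == v) * \sum_w m (rshift n w))%N.
  rewrite /monomial_image mnm_sumE big_split_ord /= big1 => [|w _].
    rewrite big_distrr; apply: eq_bigr => w _.
    by rewrite mulmnE /g sply mnmDE lrshift_mnm1 rshift_mnm1.
  by rewrite mulmnE /g splx lrshift_mnm1.
have aN : a \notin neighborhood G a by rewrite inE adj_irrefl.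
have sum1 (v : 'I_n) : (\sum_w (v == w) = 1)%N.
  by rewrite (bigD1 v) //= eqxx big1 // => w; rewrite eq_sym => /negPf->.
have coord (u w : 'I_n) v : let m' := (Ux a + Ux u + Uy w)%MM in
    m' (lshift n v) = ((a == v) + (u == v))%N /\ m' (rshift n v) = (w == v) :> nat.
  by rewrite /= !mnmDE !(lshift_mnm1, rshift_mnm1, rlshift_mnm1, lrshift_mnm1) addn0.
have coordN v : let M := (Ux a + Ux b + Ux c + Uy a)%MM in
    M (lshift n v) = ((a == v) + (b == v) + (c == v))%N /\ M (rshift n v) = (a == v) :> nat.
  by rewrite /= !mnmDE !(lshift_mnm1, rshift_mnm1, rlshift_mnm1, lrshift_mnm1) addn0.
(* The two preimages are treated alike: b and c are u and w in one order or the
   other. *)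
have fwd u w : u \notin neighborhood G a -> w \notin neighborhood G a -> w != a ->
    (forall v, (b == v) + (c == v) = (u == v) + (w == v))%N ->
    m = (Ux a + Ux u + Uy w)%MM ->
    kept keep m && (monomial_image g m == (Ux a + Ux b + Ux c + Uy a)%MM).
  move=> uN wN wa bc_uw mE; apply/andP; split.
    apply/forallP => i; apply/implyP; rewrite mE -[i]splitK; case: (split i) => v /=.
      rewrite (coord u w v).1 /keep splx.
      by case: (a =P v) => [<- //|_]; case: (u =P v) => [<- //|_].
    by rewrite (coord u w v).2 /keep sply; case: (w =P v) => [<-|_ //]; rewrite wa.
  apply/eqP/mnmP => i; rewrite -[i]splitK; case: (split i) => v /=.
    by rewrite imx mE (coord u w v).1 (coord u w v).2 (coordN v).1 -!addnA bc_uw.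
  rewrite imy (coordN v).2 mE (eq_bigr (fun v => (w == v) : nat)) ?sum1 ?muln1 // => t _.
  by rewrite (coord u w t).2.
apply/idP/idP => [/andP[/forallP km /eqP imE]|/orP[] /eqP mE]; last first.
- by apply: (fwd c b) => // v; rewrite addnC.
- exact: (fwd b c).
have mxy v : (m (lshift n v) + m (rshift n v) = (a == v) + (b == v) + (c == v))%N.
  by rewrite -imx imE (coordN v).1.
have my1 : (\sum_w m (rshift n w) == 1)%N.
  by have := imy a; rewrite imE (coordN a).2 eqxx mul1n => <-.
have mya : m (rshift n a) = 0%N.
  by have := km (rshift n a); rewrite /keep sply eqxx /= implybF negbK => /eqP.
(* Exactly one y_v occurs in m, and v is b or c. *)
have [v0 [_ my_v0 my_v]] := sum_nat_eq1 _ _ my1.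
have myE v : m (rshift n v) = (v0 == v).
  by case: (eqVneq v0 v) => [<- //|]; rewrite eq_sym => /my_v->.
have /orP[] : (v0 == c) || (v0 == b).
  have := mxy v0; rewrite my_v0 ![_ == v0]eq_sym.
  have -> : (v0 == a) = false by apply/eqP => v0a; rewrite -v0a my_v0 in mya.
  by case: (v0 == b); case: (v0 == c); rewrite ?addn1.
- move/eqP=> v0E; apply/orP; left; apply/eqP/mnmP => i; rewrite -[i]splitK.
  case: (split i) => v /=; last by rewrite myE (coord b c v).2 v0E.
  by have := mxy v; rewrite (coord b c v).1 myE v0E => /addIn.
- move/eqP=> v0E; apply/orP; right; apply/eqP/mnmP => i; rewrite -[i]splitK.
  case: (split i) => v /=; last by rewrite myE (coord c b v).2 v0E.
  by have := mxy v; rewrite (coord c b v).1 myE v0E addnAC => /addIn.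
Qed.

(** The unknown r of the linear system is the component of u in Q_c; the other
    two equations say that u - r is in Q_a and in Q_b. Over the pushforward,
    where coefficients act by their p-th powers, u ^+ (p - 2) * (u x_c f_ab) is
    a solution, because u u = u x_a f_bc + u x_c f_ab with the first term in
    both Q_a and Q_b. *)
Theorem F_pure_AT_free p (kp : p \in [pchar k]) : F_pure (pchar_RG G kp) -> AT_free G.
Proof.
move=> FpA a b c [abc [+ + +]]; move: abc; rewrite /= !inE negb_or andbT.
case/andP=> /andP[nab nac] nbc.
case/avoiding_binomial=> qc [qcN aNc bNc Jc].
case/avoiding_binomial=> qa [qaN bNa cNa Ja].
case/avoiding_binomial=> qb [qbN cNb aNb Jb].
set hc := \prod_(w <- qc) x w in Jc *; set ha := \prod_(w <- qa) x w in Ja *.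
set hb := \prod_(w <- qb) x w in Jb *.
pose u : R := x b * f a c.
have uE : u = x a * f b c + x c * f a b by rewrite /u /fbin; ring.
have [p' pE] : exists p', p = p'.+2.
  by case: p {FpA} kp => [|[|p']] /pcharf_prime //; exists p'.
pose pr (s : R) : RG k G := \pi_({ideal_quot J}) s.
have prM s t : pr (s * t) = pr s * pr t by apply: (rmorphM \pi_({ideal_quot J})).
have prX s : pr (s ^+ p) = pr s ^+ p by apply: (rmorphXn \pi_({ideal_quot J})).
have prP s t : pr s = pr t <-> s - t \in J.
  by rewrite /pr Quotient.idealrBE; split=> [->|/eqP //]; apply: eqxx.
(* The last equation is h_b r = h_b u, whose right-hand side is zero in R/J
   because u is a multiple of f_ac. *)
pose h := nth 0 [:: hc; ha; hb]; pose d := nth 0 [:: 0; ha * u; 0].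
pose q := u ^+ p' * (u * x c * f a b).
have hq (i : 'I_3) : h i ^+ p * q - d i ^+ p \in J.
  have mem s t : t \in J -> s * t \in J by apply: ideal_genM.
  case: i => -[|[|[|//]]] i3; rewrite /h /d /= pE.
  - rewrite expr0n subr0 exprS /q.
    have -> : hc * hc ^+ p'.+1 * (u ^+ p' * (u * x c * f a b)) =
       hc ^+ p'.+1 * u ^+ p' * u * x c * (hc * f a b) by ring.
    exact: mem.
  - have -> : ha ^+ p'.+2 * q - (ha * u) ^+ p'.+2 =
       - (ha ^+ p'.+1 * u ^+ p' * u * x a) * (ha * f b c).
      rewrite exprMn /q [u ^+ p'.+2]exprS [u ^+ p'.+1]exprS [ha ^+ p'.+2]exprS.
      have -> : u * x c * f a b = u * (u - x a * f b c) by rewrite {3}uE; ring.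
      by ring.
    exact: mem.
  - rewrite expr0n subr0 exprS /q {2}/u.
    have -> : hb * hb ^+ p'.+1 * (u ^+ p' * (x b * f a c * x c * f a b)) =
       - (hb ^+ p'.+1 * u ^+ p' * x b * x c * f a b) * (hb * f c a).
      by rewrite /fbin; ring.
    exact: mem.
have [|X XP] := @F_pure_linear_system _ _ _ _ (\row_(i < 3) pr (h i)) (\row_i pr (d i))
  (pr q) FpA.
  by move=> i; rewrite !mxE -!prX -prM; apply/prP.
pose r : R := repr (X : {ideal_quot J}).
have rX : pr r = X by apply: reprK.
have {}XP i : (i < 3)%N -> h i * r - d i \in J.
  by move=> i3; apply/prP; rewrite prM rX; have := XP (Ordinal i3); rewrite !mxE.
have Jr0 := XP 0%N isT; have Jr1 := XP 1%N isT; have Jr2 := XP 2%N isT.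
rewrite /h /d /= subr0 in Jr0; rewrite /h /d /= subr0 in Jr2.
rewrite /h /d /= -mulrBr in Jr1.
have r1 := mcoeff_flat nac nbc aNc bNc qcN Jr0.
have r2 : r@_(Ux a + Ux c + Uy b) = 0 by apply: mcoeff_flat Jr2; rewrite // eq_sym.
have := mcoeff_parallel nab nbc nac bNa cNa qaN Jr1.
rewrite !mcoeffB r1 r2 !sub0r -opprD => /eqP; rewrite oppr_eq0.
have -> : u = 'X_[Ux a + Ux b + Uy c] - 'X_[Ux b + Ux c + Uy a].
  by rewrite !mpolyXD /u /fbin /xvar /yvar; ring.
rewrite !mcoeffB !mcoeffX eqxx.
have neq (v1 v2 w1 w2 v w : 'I_n) : v != w ->
    (Ux v1 + Ux v2 + Uy v == Ux w1 + Ux w2 + Uy w)%MM = false.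
  move=> vw; apply/eqP => /mnmP/(_ (rshift n v)).
  by rewrite !mnmDE !rshift_mnm1 !lrshift_mnm1 eqxx eq_sym (negPf vw).
have ncb : c != b by rewrite eq_sym.
by rewrite !neq // !subr0 addr0 oner_eq0.
Qed.
End Obstruction.

(** * The equivalence *)

Theorem corollary5p7 (n : nat) (G : sgraph 'I_n) (chordalG : chordal G) :
  [<-> forall (p : nat) (p_pr : prime p), RG_F_pure_in_char G p_pr;
       exists (p : nat) (p_pr : prime p), RG_F_pure_in_char G p_pr;
       AT_free G;
       weakly_closed G].
Proof.
tfae.
- by move=> Fp; exists 2%N, isT.
- by case=> p [p_pr Fp]; apply: F_pure_AT_free Fp.
- case/(chordal_interval_labeling chordalG) => s Gs; exists s => i j k ij ik kj.
  by left; apply: Gs ij ik kj.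
- move=> /weakly_closed_AT_free/(chordal_interval_labeling chordalG)[s Gs] p p_pr.
  exact: F_pure_of_interval_labeling Gs.
Qed.
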